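(* There is an absolute constant $C>0$ such that for every $n \ge 1$, every graph $G$ on $n$ vertices with average degree $d$ can be decomposed into at most $C\, n \log\log \max(d,4)$ cycles and edges.
   Context: Graphs are finite and simple. A decomposition of $G$ into cycles and edges is a partition of the edge set $E(G)$ into sets each of which is either the edge set of a cycle of $G$ or a single edge. The average degree of $G$ is $2|E(G)|/|V(G)|$. $\log$ denotes logarithm to base $2$. *)

(* Defs.v *)
From HB Require Import structures.
From mathcomp Require Import all_boot all_order all_algebra.
From mathcomp Require Import reals exp.

Set Implicit Arguments.
Unset Strict Implicit.
Unset Printing Implicit Defensive.

Import Order.TTheory GRing.Theory Num.Theory.

(* A simple graph is a symmetric irreflexive relation [e] on a finite type; an
   edge is the two-element set of its endpoints. *)

Definition edge_set (T : finType) (e : rel T) : {set {set T}} :=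
  [set [set u.1; u.2] | u in [pred u : T * T | e u.1 u.2]].

(* [c] lists the vertices of a cycle in cyclic order, without repeating the
   first vertex at the end. *)
Definition cycle_edges (T : finType) (c : seq T) : {set {set T}} :=
  [set [set x; next c x] | x in c].

(* [ucycle] alone also accepts sequences of length 0 and 2 (an edge traversed
   back and forth), which are not cycles of a simple graph. *)
Definition is_graph_cycle (T : finType) (e : rel T) (c : seq T) : Prop :=
  (2 < size c)%N /\ ucycle e c.

Definition is_cycle_edge_set (T : finType) (e : rel T) (F : {set {set T}}) :
    Prop :=
  exists2 c : seq T, is_graph_cycle e c & F = cycle_edges c.

Definition is_single_edge (T : finType) (e : rel T) (F : {set {set T}}) :
    Prop :=
  exists2 f : {set T}, f \in edge_set e & F = [set f].

Definition cycle_edge_decomposition (T : finType) (e : rel T)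
    (P : {set {set {set T}}}) : Prop :=
  partition P (edge_set e) /\
  forall F, F \in P -> is_cycle_edge_set e F \/ is_single_edge e F.

Local Open Scope ring_scope.

Definition average_degree (R : realType) (T : finType) (e : rel T) : R :=
  2 * #|edge_set e|%:R / #|T|%:R.

Definition log2 (R : realType) (x : R) : R := ln x / ln 2.

(* Main.v *)
(* Let L be the number of edges per vertex. Removing cycles of length at least L
   costs at most n cycles. In what remains a depth-first search only sees edges
   spanning fewer than L levels, so the edges split into pieces on O(L) vertices
   with O(n) vertices in total, and it is enough to treat dense graphs: the edges
   of a graph on N <= q^20 vertices can be decomposed into O(N) cycles and
   O(q^19 N) edges. This reduces the density from L to about L^(19/20), and
   O(log log L) rounds bring it below a constant.

   For the dense case, cut along sparse cuts until every cut (S, X \ S) has at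
   least |S||X \ S|/q edges, which loses few edges. Then, growing from N(x) by
   adding the vertices with many neighbours in the current set, one reaches every
   vertex in few steps. A greedily chosen hitting set W, much smaller than X, still
   has many vertices in each of the polynomially many neighbourhoods involved, so
   that any two vertices can be joined through W by many short paths.
   Finally X \ W is decomposed into at most 2N paths, each vertex being an end of at
   most three of them (a variant of Lovasz's theorem), and the paths are closed one
   after the other into cycles through unused edges at W; all remaining edges at W
   are left over. *)
Require Import Defs.
From mathcomp Require Import all_boot all_order all_algebra.
From mathcomp Require Import zify lra.
From mathcomp Require boolp.
From mathcomp Require Import reals exp.

Set Implicit Arguments.
Unset Strict Implicit.
Unset Printing Implicit Defensive.

(** * Edge sets, edges of a path, successive removal of cycles *)

Section Graphs.
Variable T : finType.
Implicit Types (x y u v : T) (s c : seq T) (f : {set T}) (E F G U : {set {set T}}).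
Implicit Types (A B S X W : {set T}).

Definition adj E x y := [set x; y] \in E.
Definition nb E v := [set u | adj E v u].
Definition simple E := forall f, f \in E -> #|f| = 2.
Definition within E X := forall f, f \in E -> f \subset X.
Definition deg E v := #|[set f in E | v \in f]|.
Definition touching E B := [set f in E | ~~ [disjoint f & B]].

(** A list rather than a set: edge-disjointness of several paths becomes [uniq] of a
    concatenation. *)
Definition pedges s : seq {set T} :=
  if s is x :: s' then pairmap (fun u v => [set u; v]) x s' else [::].

Lemma adjC E x y : adj E x y = adj E y x.
Proof. by rewrite /adj setUC. Qed.

Lemma adj_neq E x y : simple E -> adj E x y -> x != y.
Proof. by move=> sE /sE; rewrite cards2; case: (x != y). Qed.

Lemma simpleS E F : F \subset E -> simple E -> simple F.
Proof. by move=> /subsetP sFE sE f /sFE/sE. Qed.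

Lemma withinS E F X : F \subset E -> within E X -> within F X.
Proof. by move=> /subsetP sFE sE f /sFE/sE. Qed.

Lemma simple_edge E f : simple E -> f \in E ->
  exists x y, [/\ x != y, f = [set x; y] & adj E x y].
Proof.
move=> sE fE; have /eqP/cards2P [x [y [nxy def_f]]] := sE f fE.
by exists x, y; rewrite /adj -def_f.
Qed.

Lemma within_adj E X x y : within E X -> adj E x y -> x \in X /\ y \in X.
Proof.
move=> wE /wE /subsetP sX.
by split; apply: sX; rewrite !inE eqxx ?orbT.
Qed.

Lemma set2_eq x y u v : [set x; y] = [set u; v] ->
  (x = u /\ y = v) \/ (x = v /\ y = u).
Proof.
move=> e; have H z : (z == x) || (z == y) = (z == u) || (z == v).
  by have := congr1 (fun A : {set T} => z \in A) e; rewrite !inE.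
have := H x; have := H y; rewrite !eqxx orbT /=.
case: (eqVneq x u) => [xu|nxu] /=.
  case: (eqVneq y v) => [->|_]; first by left.
  rewrite orbF => /esym/eqP yu _; left; split=> //.
  by have := H v; rewrite xu yu eqxx orbT orbb => /eqP ->.
move=> yuv /esym/eqP xv; right; split=> //.
by have := H u; rewrite eqxx (eq_sym u x) (negPf nxu) /= => /eqP.
Qed.

Lemma set2_injr x u v : [set x; u] = [set x; v] -> u = v.
Proof. by case/set2_eq => [[]|[-> ->]]. Qed.

Lemma pedges_cons x y s : pedges [:: x, y & s] = [set x; y] :: pedges (y :: s).
Proof. by []. Qed.

Lemma pedges_cat x s1 y s2 :
  pedges (x :: s1 ++ y :: s2) = pedges (x :: s1) ++ [set last x s1;
    y] :: pedges (y :: s2).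
Proof. by rewrite /= pairmap_cat. Qed.

Lemma pedges_rcons x s y :
  pedges (rcons (x :: s) y) = rcons (pedges (x :: s)) [set last x s; y].
Proof. by rewrite rcons_cons -cats1 pedges_cat cats1. Qed.

Lemma perm_pedges_rev s : perm_eq (pedges (rev s)) (pedges s).
Proof.
elim: s => // x [|y s] IH //.
rewrite rev_cons; case def_r: (rev (y :: s)) => [|z r].
  by move: (congr1 size def_r); rewrite size_rev.
rewrite pedges_rcons -def_r pedges_cons perm_rcons.
have -> : last z r = y.
  by have := congr1 (last x) def_r; rewrite rev_cons last_rcons /= => ->.
by rewrite setUC perm_cons.
Qed.

Lemma path_pedges E x s : path (adj E) x s = all (mem E) (pedges (x :: s)).
Proof. by elim: s x => //= y s IH x; rewrite IH. Qed.

Lemma pedges_mem s f x : f \in pedges s -> x \in f -> x \in s.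
Proof.
elim: s => // y [|z s] IH //; rewrite pedges_cons inE => /orP [/eqP ->|fs xf].
  by rewrite !inE => /orP [] /eqP ->; rewrite eqxx ?orbT.
by rewrite inE IH ?orbT.
Qed.

Lemma uniq_pedges s : uniq s -> uniq (pedges s).
Proof.
elim: s => // x [|y s] IH // /andP [nx us].
rewrite pedges_cons cons_uniq IH // andbT.
by apply: contra nx => /pedges_mem; apply; rewrite !inE eqxx.
Qed.

Lemma size_pedges s : size (pedges s) = (size s).-1.
Proof. by case: s => //= x s; rewrite size_pairmap. Qed.

(** Replaces the edges given by [next] by those of a closed walk, to which the lemmas on paths
    apply. *)
Lemma mem_cycle_edges x s f : uniq (x :: s) ->
  (f \in cycle_edges (x :: s)) = (f \in pedges (x :: rcons s x)).
Proof.
move=> us; apply/imsetP/idP.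
  case=> y yc ->; rewrite next_nth yc /=.
  set i := index y (x :: s).
  have ilt : (i < size (x :: s))%N by rewrite index_mem.
  have -> : [set y; nth x s i] = nth set0 (pedges (x :: rcons s x)) i.
    by rewrite (nth_pairmap x) ?size_rcons // -rcons_cons nth_rcons ilt nth_index //
      nth_rcons_default.
  by apply: mem_nth; rewrite size_pedges /= size_rcons.
move/(nthP set0) => [i]; rewrite size_pedges /= size_rcons => ilt <-.
have ilt' : (i < size (x :: s))%N by [].
exists (nth x (x :: s) i); first exact: mem_nth.
rewrite (nth_pairmap x) ?size_rcons // -rcons_cons nth_rcons ilt' nth_rcons_default.
have nx : next (x :: s) (nth x (x :: s) i) = nth x s i.
  by rewrite next_nth mem_nth // index_uniq.
by rewrite -nx.
Qed.

Lemma cycle_adj_sub E c : cycle (adj E) c -> uniq c -> cycle_edges c \subset E.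
Proof.
move=> cc uc; apply/subsetP => f; case: c cc uc => [|x s] cc uc.
  by case/imsetP.
rewrite mem_cycle_edges // => fs; move: cc; rewrite /= path_pedges => /allP.
by apply.
Qed.

(** Each cycle is taken from what the earlier ones left, so the [k] removed cycles are
    edge-disjoint. The edges that remain at the end will become single edges. *)
Inductive strips : nat -> {set {set T}} -> {set {set T}} -> Prop :=
| strips0 E : strips 0 E E
| stripsS k c E F : (2 < size c)%N -> uniq c -> cycle (adj E) c ->
    strips k (E :\: cycle_edges c) F -> strips k.+1 E F.

Lemma strips_trans k1 k2 E1 E2 E3 :
  strips k1 E1 E2 -> strips k2 E2 E3 -> strips (k1 + k2) E1 E3.
Proof.
move=> H; elim: H => {k1 E1 E2} // k c E F c2 uc cc _ IH /IH.
exact: stripsS.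
Qed.

Lemma strips_sub k E F : strips k E F -> F \subset E.
Proof.
elim=> {k E F} // k c E F _ _ _ _ /subset_trans; apply; exact: subsetDl.
Qed.

Lemma adj_sub E F : E \subset F -> subrel (adj E) (adj F).
Proof. by move/subsetP => sEF x y /sEF. Qed.

(** Further edges are carried along untouched, so that removals in disjoint edge sets can be
    performed one after the other. *)
Lemma strips_frame k E F G :
  strips k E F -> [disjoint E & G] -> strips k (E :|: G) (F :|: G).
Proof.
elim=> {k E F} [E|k c E F c2 uc cc _ IH] dEG; first exact: strips0.
have sc := cycle_adj_sub cc uc.
apply: (@stripsS _ c) => //.
  by apply: sub_cycle cc; apply: adj_sub; apply: subsetUl.
have -> : (E :|: G) :\: cycle_edges c = (E :\: cycle_edges c) :|: G.
  apply/setP => f; rewrite !inE; case fc: (f \in cycle_edges c) => //=.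
  by rewrite (disjointFr dEG) // (subsetP sc).
by apply: IH; apply: disjointWl dEG; apply: subsetDl.
Qed.

Lemma strips_disjointU k1 k2 E1 E2 F1 F2 : [disjoint E1 & E2] ->
  strips k1 E1 F1 -> strips k2 E2 F2 ->
  strips (k1 + k2) (E1 :|: E2) (F1 :|: F2).
Proof.
move=> d12 s1 s2; apply: strips_trans (strips_frame s1 d12) _.
rewrite setUC [F1 :|: _]setUC; apply: strips_frame => //.
rewrite disjoint_sym; apply: disjointWl d12; exact: strips_sub s1.
Qed.

Lemma partition_setU1 (I : finType) (P : {set {set I}}) (A D : {set I}) :
  A \subset D -> A != set0 -> partition P (D :\: A) -> partition (A |: P) D.
Proof.
move=> sAD An0 pP; rewrite -(setID D A) (setIidPr sAD).
by apply: partitionU1 => //; rewrite disjoint_sym disjoints_subset subsetDr.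
Qed.

Lemma partition_set1 E : partition [set [set f] | f in E] E.
Proof.
apply/and3P; split.
- rewrite /cover big_imset /=; last by move=> f g _ _ /set1_inj.
  apply/eqP/setP => f; apply/bigcupP/idP => [[g gE /set1P -> //]|fE].
  by exists f; rewrite ?set11.
- apply/trivIsetP => _ _ /imsetP [f _ ->] /imsetP [g _ ->] nfg.
  by rewrite disjoints1 inE; apply: contra nfg => /eqP ->.
- by apply/imsetP => -[f _ /setP/(_ f)]; rewrite !inE eqxx.
Qed.

Lemma strips_decomposition k E F : strips k E F ->
  exists P, [/\ partition P E, #|P| <= k + #|F| &
    forall C, C \in P ->
      (exists c, [/\ 2 < size c, uniq c, cycle (adj E) c & C = cycle_edges c]) \/
      (exists2 f, f \in E & C = [set f])].
Proof.
elim=> {k E F} [E|k c E F c2 uc cc _ [P [pP cP HP]]].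
  exists [set [set f] | f in E]; split.
  - exact: partition_set1.
  - by rewrite add0n leq_imset_card.
  - by move=> C /imsetP [f fE ->]; right; exists f.
have sc := cycle_adj_sub cc uc.
exists (cycle_edges c |: P); split.
- apply: partition_setU1 => //; case: c c2 {uc cc sc pP HP} => // x s _.
  by apply/set0Pn; exists [set x; next (x :: s) x]; apply: imset_f; apply: mem_head.
- by apply: leq_trans (leq_card_setU _ _) _; rewrite cards1 addSn.
- move=> C /setU1P [->|/HP [[c' [? ? c'c ->]]|[f /setDP [fE _] ->]]].
  + by left; exists c.
  + left; exists c'; split=> //; apply: sub_cycle c'c; apply: adj_sub;
    exact: subsetDl.
  + by right; exists f.
Qed.

End Graphs.

(** * Adding an edge to a path decomposition *)

Section Paths.
Variable T : finType.
Implicit Types (x y u v a b : T) (s h : seq T) (f : {set T}) (E F : {set {set T}}).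
Implicit Types (hs ps fs : seq (seq T)) (qs : seq (seq T * seq T)).

Lemma all2_catl (I : Type) (r : rel I) (s1 s2 t : seq I) : all2 r (s1 ++ s2) t ->
  exists t1 t2, [/\ t = t1 ++ t2, all2 r s1 t1 & all2 r s2 t2].
Proof.
elim: s1 t => [|x s1 IH] [|y t] //=.
- by exists [::], [::].
- by exists [::], (y :: t).
case/andP=> rxy /IH [t1 [t2 [-> r1 r2]]].
by exists (y :: t1), t2; rewrite /= rxy.
Qed.

Lemma all2_cat (I : Type) (r : rel I) (s1 s2 t1 t2 : seq I) :
  all2 r s1 t1 -> all2 r s2 t2 -> all2 r (s1 ++ s2) (t1 ++ t2).
Proof. by elim: s1 t1 => [|x s1 IH] [|y t1] //= /andP [-> /IH]. Qed.

Definition flip h h' := (h' == h) || (h' == rev h).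
Definition heads hs := pmap ohead hs.
Definition lasts hs := pmap (fun h => ohead (rev h)) hs.

Lemma heads_cat hs1 hs2 : heads (hs1 ++ hs2) = heads hs1 ++ heads hs2.
Proof. exact: pmap_cat. Qed.

Lemma lasts_cat hs1 hs2 : lasts (hs1 ++ hs2) = lasts hs1 ++ lasts hs2.
Proof. exact: pmap_cat. Qed.

Lemma flip_refl hs : all2 flip hs hs.
Proof. by elim: hs => //= h hs ->; rewrite /flip eqxx. Qed.

(* The far end [a] of a half can take over the role of its near end [x]; then
   [x] has to be attached by something else, and the half is out of play. *)
Lemma flip_heads hs a (fr : pred T) :
  uniq (heads hs) -> a \notin heads hs ->
  (forall v, v \in a :: heads hs -> (v \in lasts hs) || fr v) ->
  exists hs' u, [/\ all2 flip hs hs', fr u & perm_eq (u :: heads hs') (a :: heads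
    hs)].
Proof.
have [n] := ubnP (size (heads hs)); elim: n hs a => // n IH hs a ltn uhs nahs Hv.
have /orP [|fra] := Hv a (mem_head _ _); last first.
  by exists hs, a; split=> //; apply: flip_refl.
rewrite /lasts mem_pmap => /mapP [h hhs]; case: (lastP h) hhs => // s z hhs.
rewrite rev_rcons /= => -[za]; subst z.
case def_h: (rcons s a) hhs => [|x h']; first by case: (s) def_h.
move=> hhs; case: (splitPr hhs) uhs nahs Hv ltn => h1 h2 uhs nahs Hv ltn.
have hds : heads (h1 ++ (x :: h') :: h2) = heads h1 ++ x :: heads h2 by rewrite
  heads_cat.
have lts : lasts (h1 ++ (x :: h') :: h2) = lasts h1 ++ a :: lasts h2.
  by rewrite lasts_cat /= -def_h rev_rcons.
rewrite hds lts in uhs nahs Hv ltn.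
have px : perm_eq (heads h1 ++ x :: heads h2) (x :: heads h1 ++ heads h2).
  by rewrite perm_sym -cat1s perm_catCA.
have {uhs} := uhs; rewrite (perm_uniq px) /= => /andP [nx uhs].
(* The half used up is replaced by an empty one instead of being deleted, which keeps the positions
   aligned for [all2 flip]. *)
have hd0 : heads (h1 ++ [::] :: h2) = heads h1 ++ heads h2 by rewrite heads_cat.
have lt0 : lasts (h1 ++ [::] :: h2) = lasts h1 ++ lasts h2 by rewrite lasts_cat.
have := IH (h1 ++ [::] :: h2) x; rewrite hd0 lt0.
case=> [||//|v vx|].
- move: ltn; rewrite !size_cat /=; lia.
- by [].
- have va : v \in heads h1 ++ x :: heads h2 by rewrite (perm_mem px).
  have := Hv v; rewrite inE va orbT => /(_ isT); rewrite !mem_cat inE.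
  by case: eqVneq va nahs => //= -> ->.
move=> hs0 [u [r0 fru pu]].
have [h1' [t [def0 r1 rt]]] := all2_catl r0.
case: t def0 rt => //= g h2' def0 /andP [/orP rg r2].
have {rg} g0 : g = [::] by case: rg => /eqP.
subst g hs0; exists (h1' ++ rev (x :: h') :: h2'), u; split=> //.
  by apply: all2_cat => //=; rewrite r2 /flip eqxx orbT.
rewrite hds; apply: (@perm_trans _ (a :: u :: heads h1' ++ heads h2')).
  rewrite heads_cat /= -def_h rev_rcons /=.
  by rewrite -cat_cons -(cat1s a (heads h2')) perm_catCA.
rewrite perm_cons; apply: perm_trans (_ : perm_eq _ (x :: heads h1 ++ heads h2)) _.
  by move: pu; rewrite heads_cat.
by rewrite perm_sym.
Qed.

Definition ends s := if s is x :: s' then [:: x; last x s'] else [::].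
(* A one-vertex path counts twice as an end of its vertex. *)
Definition endnum ps v := count_mem v (flatten (map ends ps)).
(** As [enum E] has no repetition, [perm_eq] says at once that the paths are edge-disjoint and that
    they cover [E]. *)
Definition path_dec E ps :=
  all uniq ps /\ perm_eq (flatten (map (@pedges T) ps)) (enum E).

Lemma ends_rev s : perm_eq (ends (rev s)) (ends s).
Proof.
case: s => // x s; case: (lastP s) => // s' y.
rewrite rev_cons rev_rcons rcons_cons /= !last_rcons.
by apply/permP => p /=; lia.
Qed.

(* A path through [b] is stored as a pair of halves, both listed from the vertex
   next to [b] outwards; a half may be empty. *)
Definition jn b (p : seq T * seq T) := rev p.1 ++ b :: p.2.

Lemma ends_jn b p : ends (jn b p) = [:: last b p.1; last b p.2].
Proof.
case: p => h1 h2; rewrite /jn /=; case: (lastP h1) => // s z.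
by rewrite rev_rcons last_rcons /= last_cat.
Qed.

Lemma count_pedges_jn b p (P : pred {set T}) :
  count P (pedges (jn b p)) = count P (pedges p.1) + count P (pedges p.2) +
    count P [seq [set b; x] | x <- heads [:: p.1; p.2]].
Proof.
case: p => h1 h2; rewrite /jn -[ [:: _; _]]cat1s heads_cat map_cat count_cat.
rewrite -[LHS]/(count P (pedges (rev h1 ++ b :: h2))) -[(_, _).1]/h1 -[(_, _).2]/h2.
have e2 : count P (pedges (b :: h2)) =
    count P (pedges h2) + count P [seq [set b; x] | x <- heads [:: h2]].
  by case: h2 => //= x s; lia.
case: h1 => [|z s]; first by rewrite e2.
have := perm_pedges_rev (z :: s); rewrite rev_cons.
case def_r: (rcons (rev s) z) => [|y r]; first by case: (rev s) def_r.
rewrite cat_cons pedges_cat => /permP /(_ P) e1.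
have -> : last y r = z by have := congr1 (last z) def_r; rewrite last_rcons.
have cc f l : count P (f :: l) = P f + count P l by [].
by rewrite count_cat e1 cc e2 [ [set z; b]]setUC /=; lia.
Qed.

(** A single list of all halves, on whichever side of [b], so that [flip_heads] can reverse each of
    them independently. *)
Definition halves qs := unzip1 qs ++ unzip2 qs.

Lemma halves_cons p qs (I : Type) (F : seq (seq T) -> seq I) (P : pred I) :
  (forall hs1 hs2, F (hs1 ++ hs2) = F hs1 ++ F hs2) ->
  count P (F (halves (p :: qs))) = count P (F [:: p.1;
    p.2]) + count P (F (halves qs)).
Proof.
move=> Fcat; rewrite /halves /= -cat1s -[p.2 :: unzip2 qs]cat1s -[ [:: p.1;
  p.2]]cat1s.
by rewrite !(Fcat, count_cat); lia.
Qed.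

Lemma count_pedges_jns b qs (P : pred {set T}) :
  count P (flatten (map (@pedges T) (map (jn b) qs))) =
  count P (flatten (map (@pedges T) (halves qs))) +
    count P [seq [set b; x] | x <- heads (halves qs)].
Proof.
elim: qs => // p qs IH; rewrite /= count_cat IH count_pedges_jn.
rewrite (@halves_cons _ _ _ (fun hs => flatten (map (@pedges T) hs))); last first.
  by move=> hs1 hs2; rewrite map_cat flatten_cat.
rewrite (@halves_cons _ _ _ (fun hs => [seq [set b; x] | x <- heads hs])); last first.
  by move=> hs1 hs2; rewrite heads_cat map_cat.
rewrite /= cats0 count_cat; lia.
Qed.

Lemma endnum_jns b qs v :
  endnum (map (jn b) qs) v = count_mem v (map (last b) (halves qs)).
Proof.
elim: qs => // p qs IH; rewrite /endnum [flatten _]/= count_cat -/(endnum _ _) IH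
  ends_jn.
rewrite (halves_cons _ _ _ (@map_cat _ _ (last b))) /=; lia.
Qed.

(** Reversing a nonempty half exchanges its first and its last vertex; an empty half has no head,
    and its last vertex is [b] before and after. *)
Lemma flip_count_last b hs hs' v : all2 flip hs hs' ->
  count_mem v (map (last b) hs') + count_mem v (heads hs') =
  count_mem v (map (last b) hs) + count_mem v (heads hs).
Proof.
elim: hs hs' => [|h hs IH] [|h' hs'] // /andP [r /IH {IH} e].
suff : (last b h' == v) + count_mem v (heads [:: h']) =
       (last b h == v) + count_mem v (heads [:: h]).
  rewrite -[h' :: hs']cat1s -[h :: hs]cat1s !(map_cat, heads_cat, count_cat) /= =>
    e1; move: e1 e => /=; lia.
case/orP: r => /eqP -> //; case: h => // x s; case: (lastP s) => // s' y.
rewrite rev_cons rev_rcons rcons_cons /heads /= !last_rcons; lia.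
Qed.

Lemma flip_count_pedges hs hs' (P : pred {set T}) : all2 flip hs hs' ->
  count P (flatten (map (@pedges T) hs')) = count P (flatten (map (@pedges T) hs)).
Proof.
elim: hs hs' => [|h hs IH] [|h' hs'] //= /andP [r /IH {IH} e].
rewrite !count_cat e; congr (_ + _); case/orP: r => /eqP -> //.
exact: (permP (perm_pedges_rev h)).
Qed.

Lemma flip_halves qs hs' : all2 flip (halves qs) hs' ->
  exists2 qs', hs' = halves qs' &
    all2 (fun p p' => flip p.1 p'.1 && flip p.2 p'.2) qs qs'.
Proof.
rewrite /halves => /all2_catl [t1 [t2 [-> r1 r2]]].
suff [qs' [-> ->] r] : exists2 qs', t1 = unzip1 qs' /\ t2 = unzip2 qs' &
    all2 (fun p p' => flip p.1 p'.1 && flip p.2 p'.2) qs qs' by exists qs'.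
elim: qs t1 t2 r1 r2 => [|p qs IH] [|h1 t1] [|h2 t2] //=; first by exists [::].
move=> /andP [r1 rt1] /andP [r2 rt2]; have [qs' [-> ->] r] := IH _ _ rt1 rt2.
by exists ((h1, h2) :: qs') => //=; rewrite r1 r2.
Qed.

Lemma flip_mem h h' : flip h h' -> h' =i h /\ uniq h' = uniq h.
Proof.
by case/orP => /eqP -> //; split; [move=> x; rewrite mem_rev | rewrite rev_uniq].
Qed.

Lemma flip_uniq_jn b qs qs' :
  all2 (fun p p' => flip p.1 p'.1 && flip p.2 p'.2) qs qs' ->
  all uniq (map (jn b) qs) -> all uniq (map (jn b) qs').
Proof.
elim: qs qs' => [|[h1 h2] qs IH] [|[h1' h2'] qs'] //=.
case/andP=> /andP [/flip_mem [m1 u1] /flip_mem [m2 u2]] /IH {}IH /andP [u /IH ->].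
rewrite andbT; move: u; rewrite /jn /= !cat_uniq !rev_uniq /= u1 u2 !negb_or
  !mem_rev m1 m2.
case/and4P => -> /andP [-> H] -> -> /=; rewrite andbT.
by apply: contra H => /hasP [x xh]; rewrite mem_rev m1 => x1; apply/hasP; exists x;
  rewrite ?mem_rev -?m2.
Qed.

Lemma split_at b s : b \in s ->
  jn b (rev (take (index b s) s), drop (index b s).+1 s) = s.
Proof.
move=> bs; rewrite /jn /= revK -{2}(nth_index b bs) -drop_nth ?index_mem //.
exact: cat_take_drop.
Qed.

Lemma endnum_cat ps1 ps2 v : endnum (ps1 ++ ps2) v = endnum ps1 v + endnum ps2 v.
Proof. by rewrite /endnum map_cat flatten_cat count_cat. Qed.

Lemma endnum_perm ps1 ps2 : perm_eq ps1 ps2 -> endnum ps1 =1 endnum ps2.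
Proof. by move=> p v; apply: permP; apply: perm_flatten; apply: perm_map. Qed.

Lemma oriented_end u s : u \in ends s ->
  exists r, [/\ flip s (u :: r), perm_eq (ends (u :: r)) (ends s) &
                perm_eq (pedges (u :: r)) (pedges s)].
Proof.
case: s => // x s; rewrite !inE => /orP [] /eqP ->.
  by exists s; rewrite /flip eqxx.
have := ends_rev (x :: s); have := perm_pedges_rev (x :: s).
have : flip (x :: s) (rev (x :: s)) by rewrite /flip eqxx orbT.
case: (lastP s) => [|s' y]; first by exists [::].
rewrite last_rcons rev_cons rev_rcons rcons_cons => *.
by exists (rcons (rev s') x).
Qed.

(** The paths through [b] are cut at [b]; the heads of the halves are then the neighbours of [b].
    Reversing suitable halves makes [a] a vertex next to [b] at the expense of some [u], and the
    edge from [u] to [b] is appended to a path that ends in [u] and avoids [b]. *)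
Lemma path_dec_add_edge E ps a b : path_dec E ps -> a != b ->
  [set a; b] \notin E -> 0 < endnum ps a ->
  (forall v, adj E v b -> 0 < endnum ps v) ->
  exists2 ps', path_dec ([set a; b] |: E) ps' &
    forall v, endnum ps' v + (a == v) = endnum ps v + (b == v).
Proof.
move=> [ups pps] nab nabE Da Db.
pose fs := [seq s <- ps | b \notin s]; pose ts := [seq s <- ps | b \in s].
pose qs := [seq (rev (take (index b s) s), drop (index b s).+1 s) | s <- ts].
have def_ts : map (jn b) qs = ts.
  rewrite -map_comp -[RHS]map_id; apply/eq_in_map => s.
  by rewrite mem_filter => /andP [bs _]; apply: split_at.
have pps2 : perm_eq ps (map (jn b) qs ++ fs).
  by rewrite def_ts perm_sym perm_filterC.
have uq : all uniq (map (jn b) qs).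
  by move: ups; rewrite (perm_all _ pps2) all_cat => /andP [].
have ufs : all uniq fs by move: ups; rewrite (perm_all _ pps2) all_cat => /andP [].
have cE P : count P (flatten (map (@pedges T) (halves qs))) +
    count P [seq [set b; x] | x <- heads (halves qs)] +
    count P (flatten (map (@pedges T) fs)) = count P (enum E).
  rewrite -(permP pps) -count_pedges_jns -count_cat -flatten_cat -map_cat.
  by apply: permP; apply: perm_flatten; apply: perm_map; rewrite perm_sym.
have pE : perm_eq (flatten (map (@pedges T) (halves qs)) ++
    [seq [set b; x] | x <- heads (halves qs)] ++
    flatten (map (@pedges T) fs)) (enum E).
  by apply/permP => P; rewrite !count_cat addnA cE.
have headE x : x \in heads (halves qs) -> adj E x b.
  move=> xh; rewrite /adj -mem_enum -(perm_mem pE) !mem_cat setUC.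
  by rewrite (map_f (fun x => [set b; x])) // orbT.
have uh : uniq (heads (halves qs)).
  apply: (@map_uniq _ _ (fun x => [set b; x])).
  have := enum_uniq E; rewrite -(perm_uniq pE) !cat_uniq => /and3P [_ _].
  by case/and3P.
have nah : a \notin heads (halves qs) by apply: contra nabE => /headE.
have nbh p h : p \in qs -> h \in [:: p.1; p.2] -> b \notin h.
  move=> pq; have /allP/(_ (jn b p)) := uq; rewrite map_f // => /(_ isT).
  rewrite /jn cat_uniq /= mem_rev !inE => /and4P [_ /norP [n1 _] n2 _].
  by move=> /orP [] /eqP ->.
(* Such a [v] is an end of some path and differs from [b]: if the path passes through [b], then [v]
   is the far end of a half. *)
have Hends v : v \in a :: heads (halves qs) ->
    (v \in lasts (halves qs)) || (v \in flatten (map ends fs)).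
  move=> vh; have nvb : v != b.
    move: vh; rewrite inE => /orP [/eqP ->//|]; rewrite /heads mem_pmap.
    move=> /mapP [h hh hv]; apply/eqP => vb.
    have bh : b \in h by move: hv; rewrite -vb; case: (h) => //= x s [->];
      rewrite mem_head.
    move: hh; rewrite /halves mem_cat => /orP [] /mapP [p pq hp];
      have := nbh p h pq; rewrite hp !inE eqxx ?orbT /= => /(_ isT);
        by rewrite -hp bh.
  have : 0 < endnum ps v.
    move: vh; rewrite inE => /orP [/eqP -> //|/headE]; exact: Db.
  rewrite (endnum_perm pps2) endnum_cat endnum_jns addn_gt0 -!has_count !has_pred1.
  case/orP => [|-> ]; last by rewrite orbT.
  case/mapP => h hh vl; apply/orP; left; rewrite /lasts mem_pmap.
  apply/mapP; exists h => //; case: (lastP h) vl => [vb|s z].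
    by rewrite vb eqxx in nvb.
  by rewrite last_rcons rev_rcons => ->.
(* The vertices next to [b] are now [a] and the old heads, without [u]; the path [s] that ends in
   [u] is one of those avoiding [b]. *)
have [hs' [u [rhs' fru pu]]] := flip_heads uh nah Hends.
have [qs' def_hs' rq] := flip_halves rhs'; subst hs'.
have [s sfs us] : exists2 s, s \in fs & u \in ends s.
  by case/flattenP: fru => es /mapP [s sfs ->] ues; exists s.
have [r [/flip_mem [mr ur] er pr]] := oriented_end us.
have pfs := perm_to_rem sfs.
exists (map (jn b) qs' ++ (b :: u :: r) :: rem s fs).
  split.
    move: ufs sfs; rewrite (perm_all _ pfs) mem_filter => /andP [us' ufs] /andP [bs
      _].
    have {}ufs : all uniq (rem s fs) := ufs.
    rewrite all_cat (flip_uniq_jn rq uq) andTb.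
    rewrite -[all _ _]/(uniq (b :: u :: r) && all uniq (rem s fs)) ufs andbT.
    by rewrite cons_uniq mr ur us' bs.
  apply/permP => P; rewrite map_cat flatten_cat count_cat count_pedges_jns.
  have epu : P [set b; u] + count P [seq [set b; x] | x <- heads (halves qs')] =
    P [set b; a] + count P [seq [set b; x] | x <- heads (halves qs)].
    exact: (permP (perm_map (fun x => [set b; x]) pu) P).
  have efs : count P (flatten (map (@pedges T) fs)) =
    count P (pedges s) + count P (flatten (map (@pedges T) (rem s fs))).
    by rewrite -count_cat; exact: (permP (perm_flatten (perm_map (@pedges T) pfs)) P).
  have := permP pr P => epr.
  have -> : count P (enum ([set a; b] |: E)) = P [set b; a] + count P (enum E).
    rewrite setUC -(permP (_ : perm_eq ([set b; a] :: enum E) _)) //.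
    apply: uniq_perm; rewrite /= ?enum_uniq ?andbT //;
      first by rewrite mem_enum setUC.
    by move=> f; rewrite inE !mem_enum !inE orbC (setUC [set b]).
  have ebr : count P (flatten (map (@pedges T) ((b :: u :: r) :: rem s fs))) =
      P [set b; u] + count P (pedges (u :: r)) + count P (flatten (map (@pedges T)
        (rem s fs))).
    by rewrite -[flatten _]/(pedges (b :: u :: r) ++ flatten _) count_cat.
  rewrite ebr -cE (flip_count_pedges _ rhs') efs epr.
  move: (count P (flatten _)) (count P (flatten _)) (count P (pedges s)) epu => n1
    n2 n3.
  move: (count P _) (count P _) => n4 n5.
  by move: (P _) (P _); clear; lia.
move=> v; rewrite (endnum_perm pps2) !endnum_cat !endnum_jns (endnum_perm pfs).
rewrite -!(cat1s _ (rem s fs)) !endnum_cat.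
have -> : endnum [:: s] v = (u == v) + (last u r == v).
  by rewrite /endnum /= cats0 -(permP er) /= addn0.
have -> : endnum [:: b :: u :: r] v = (b == v) + (last u r == v).
  by rewrite /endnum /= addn0.
have epu : (u == v) + count_mem v (heads (halves qs')) =
           (a == v) + count_mem v (heads (halves qs)) := permP pu (pred1 v).
move: (flip_count_last b v rhs') epu; move: (count_mem v _) (count_mem v _).
move: (count_mem v _) (count_mem v _) (endnum _ v).
by move: (u == v) (a == v) (b == v) (last u r == v); clear; lia.
Qed.

End Paths.

(** * Path decompositions with at most three ends at each vertex *)

Section PathDecomposition.
Variable T : finType.
Implicit Types (x y u v a b : T) (s h : seq T) (f : {set T}) (E F : {set {set T}}).
Implicit Types (X : {set T}) (ps : seq (seq T)).

(* [t] is the current head of a trail along which the missing edges are added;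
   adding [t b] moves one path end from [t] to [b]. *)
Definition trail_state E X F t ps :=
  [/\ path_dec F ps, t \in X /\ 1 < endnum ps t,
      forall v, v \in X -> 0 < endnum ps v <= 3,
      forall v, v \notin X -> endnum ps v = 0 &
      forall v u, v != t -> adj (E :\: F) v u -> endnum ps v <= 2].

(** The bound 2 at vertices with missing edges leaves room for the end arriving at [b], and [t] can
    spare one of its at least two ends. Afterwards [t] has at most two, as required of a vertex that
    is no longer the head. *)
Lemma trail_step E X F t ps b : within E X -> simple E -> F \subset E ->
  trail_state E X F t ps -> adj (E :\: F) t b ->
  exists ps', trail_state E X ([set t; b] |: F) b ps'.
Proof.
move=> wE sE sFE [pps [tX Dt] DX DnX D2] atb.
have sDE : E :\: F \subset E := subsetDl _ _.
have ntb := adj_neq (simpleS sDE sE) atb.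
have [_ bX] := within_adj (withinS sDE wE) atb.
have Db : endnum ps b <= 2 by apply: (D2 b t); rewrite 1?eq_sym // adjC.
have [|||ps' pps' Dps'] := path_dec_add_edge pps ntb.
- by move: atb; rewrite /adj inE => /andP [].
- exact: ltnW.
- by move=> v /(within_adj (withinS sFE wE)) [/DX /andP []].
exists ps'; split=> //.
- split=> //; have := Dps' b; have := DX _ bX; rewrite eqxx (negPf ntb); lia.
- move=> v vX; have := Dps' v; have := DX _ vX; case: eqVneq => [<-|_].
    by move: Dt; rewrite eq_sym (negPf ntb); lia.
  by case: eqVneq => [<-|_]; lia.
- move=> v vX; have := Dps' v; rewrite (DnX v vX).
  case: eqVneq => [tv|_]; first by rewrite tv (negPf vX) in tX.
  by case: eqVneq => [bv|_]; [rewrite bv (negPf vX) in bX | lia].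
move=> v u nvb avu; have := Dps' v; rewrite (eq_sym b) (negPf nvb).
case: eqVneq => [<-|ntv]; first by have := DX _ tX; lia.
suff : endnum ps v <= 2 by lia.
by apply: (D2 v u); rewrite 1?eq_sym //; move: avu;
  rewrite /adj !inE negb_or => /andP [/andP [_ ->]].
Qed.

Lemma trail_decomposition E X F t ps : within E X -> simple E -> F \subset E ->
  trail_state E X F t ps ->
  exists ps', [/\ path_dec E ps', forall v, endnum ps' v <= 3 &
                  forall v, v \notin X -> endnum ps' v = 0].
Proof.
move=> wE sE; have [n] := ubnP #|E :\: F|;
  elim: n F t ps => // n IH F t ps ltn sFE st.
have main t0 ps0 b : trail_state E X F t0 ps0 -> adj (E :\: F) t0 b ->
    exists ps', [/\ path_dec E ps', forall v, endnum ps' v <= 3 &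
                    forall v, v \notin X -> endnum ps' v = 0].
  move=> st0 ab; have [ps1] := trail_step wE sE sFE st0 ab; apply: IH.
    move: ab; rewrite /adj => ab; rewrite (setUC _ F) -setDDl.
    by move: ltn; rewrite (cardsD1 [set t0; b] (E :\: F)) ab; apply.
  by rewrite subUset sFE andbT sub1set; move: ab; rewrite /adj inE => /andP [].
have [/existsP [b]|nt] := boolP [exists b, adj (E :\: F) t b];
  first exact: (main t ps b st).
have [pps [tX Dt] DX DnX D2] := st.
have D3 v : endnum ps v <= 3.
  by have [/DX /andP []|/DnX ->] := boolP (v \in X).
have [E0|[f fEF]] := set_0Vmem (E :\: F).
  exists ps; split=> //.
  suff -> : E = F by [].
  by apply/eqP; rewrite eqEsubset sFE andbT -setD_eq0 E0.
have sDE : E :\: F \subset E := subsetDl _ _.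
have [y [z [nyz _ ayz]]] := simple_edge (simpleS sDE sE) fEF.
have [yX _] := within_adj (withinS sDE wE) ayz.
have nty : y != t.
  by apply: contra nt => /eqP <-; apply/existsP; exists z.
have D2' v u : adj (E :\: F) v u -> endnum ps v <= 2.
  case: (eqVneq v t) => [-> avu|]; last exact: D2.
  by case/negP: nt; apply/existsP; exists u.
case: (leqP (endnum ps y) 1) => Dy; last first.
  by apply: (main y ps z) => //; split=> // v u _; apply: D2'.
(* The trail is stuck at [t] and restarts at [y]. If [y] has a single end, a one-vertex path there
   raises the number to three. *)
have Dy1 v : endnum ([:: y] :: ps) v = (y == v).*2 + endnum ps v.
  by rewrite -(cat1s [:: y]) endnum_cat {1}/endnum /= addn0 addnn.
apply: (main y ([:: y] :: ps) z) => //; split=> //.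
- by rewrite Dy1 eqxx; split=> //; lia.
- move=> v vX; rewrite Dy1; have := DX v vX; case: eqVneq => [yv|_ //].
  by move: Dy; rewrite yv /=; move: (endnum ps v) => m; clear; lia.
- by move=> v vX; rewrite Dy1 DnX //; case: eqVneq => // yv; rewrite -yv yX in vX.
- by move=> v u nvy avu; rewrite Dy1 eq_sym (negPf nvy); exact: D2' avu.
Qed.

Lemma sum_endnum ps : \sum_v endnum ps v = (count (fun s => s != [::]) ps).*2.
Proof.
elim: ps => [|s ps IH]; first by rewrite big1.
transitivity (\sum_v (count_mem v (ends s) + endnum ps v)).
  by apply: eq_bigr => v _; rewrite /endnum /= count_cat.
rewrite big_split /= IH doubleD; congr (_ + _); case: s => [|x s] /=.
  by rewrite big1.
have e z : \sum_(v : T) (z == v) = 1.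
  by rewrite (bigD1 z) //= eqxx big1 // => i; rewrite eq_sym => /negPf ->.
rewrite (eq_bigr (fun v => (x == v) + (last x s == v))); last by move=> v _;
  rewrite addn0.
by rewrite big_split /= !e.
Qed.

(* A weak form of Lovasz's theorem on decompositions into n/2 paths and cycles. *)
Lemma path_decomposition E X : within E X -> simple E ->
  exists ps, [/\ path_dec E ps, forall v, endnum ps v <= 3,
    all (fun s => 1 < size s) ps & size ps <= 2 * #|X|].
Proof.
move=> wE sE.
suff [ps [[ups pps] D3 DX]] : exists ps', [/\ path_dec E ps', forall v, endnum ps' v
  <= 3 &
                  forall v, v \notin X -> endnum ps' v = 0].
  have cnt (P : pred (seq T)) v : endnum (filter P ps) v <= endnum ps v.
    elim: (ps) => // s ps' IH; rewrite -(cat1s s ps') filter_cat !endnum_cat /=.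
    by case: (P s) => /=; rewrite ?leq_add2l // (leq_trans IH) ?leq_addl.
  exists [seq s <- ps | 1 < size s]; split.
  - split; first by apply/allP => s; rewrite mem_filter => /andP [_ /(allP ups)].
    apply: perm_trans pps.
    elim: (ps) => // -[|x [|y s]] ps' IH //=; rewrite ?cat0s //.
    by rewrite perm_cons perm_cat2l.
  - by move=> v; apply: leq_trans (D3 v).
  - by apply/allP => s; rewrite mem_filter => /andP [].
  - rewrite size_filter; apply: (@leq_trans (count (fun s => s != [::]) ps)).
      by apply: sub_count => -[].
    (* Each path has two ends and each vertex of [X] carries at most three, so there are at most
       3|X|/2 paths. *)
    have : \sum_v endnum ps v <= 3 * #|X|.
      rewrite (bigID (mem X)) /= [X in _ + X]big1 ?addn0 => [|v /DX //].
      rewrite mulnC -sum_nat_const; apply: leq_sum => v _; exact: D3.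
    rewrite sum_endnum; lia.
have [X0|[t tX]] := set_0Vmem X.
  exists [::]; split=> //.
  have -> : E = set0; last by rewrite /path_dec /= enum_set0.
  apply/setP => f; rewrite inE; apply/negP => fE.
  by have := wE f fE; rewrite X0 subset0 => /eqP f0; have := sE f fE;
    rewrite f0 cards0.
(* With no edge treated yet, a one-vertex path at each vertex of [X] provides two ends
   everywhere. *)
pose ps0 := [seq [:: v] | v <- enum X].
have D0 v : endnum ps0 v = (v \in X).*2.
  rewrite /endnum -(mem_enum X) -(count_uniq_mem v (enum_uniq X)).
  by rewrite /ps0; elim: (enum X) => //= x s ->; lia.
apply: (@trail_decomposition E X set0 t ps0 wE sE (sub0set _)); split.
- split; first by apply/allP => s /mapP [v _ ->].
  by rewrite enum_set0 /ps0; elim: (enum X).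
- by rewrite D0 tX.
- by move=> v vX; rewrite D0 vX.
- by move=> v /negPf vX; rewrite D0 vX.
- by move=> v u _ _; rewrite D0; case: (v \in X).
Qed.

End PathDecomposition.

(** * Graphs without long cycles *)

Section LongCycles.
Variable T : finType.
Implicit Types (x y u v a b r : T) (s c p : seq T) (f : {set T}) (E F : {set {set
  T}}).
Implicit Types (X A B V : {set T}).

Lemma card_cycle_edges c : uniq c -> 2 < size c -> #|cycle_edges c| = size c.
Proof.
case: c => [|x [|y [|z s]]] //; set s' := z :: s => uc _.
have eq_ce : cycle_edges [:: x, y & s'] =i pedges (x :: rcons (y :: s') x).
  by move=> f; apply: mem_cycle_edges.
suff up : uniq (pedges (x :: rcons (y :: s') x)).
  by rewrite (eq_card eq_ce) (card_uniqP up) size_pedges /= size_rcons.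
rewrite -rcons_cons pedges_rcons rcons_uniq uniq_pedges // andbT.
(* The closing edge contains [x]. The only path edge at [x] is the first one, and the other
   endpoints differ because there are at least three vertices. *)
rewrite pedges_cons inE negb_or; apply/andP; split.
  apply/eqP => /set2_eq [[]|[e _]].
    by move=> /= lx; have := mem_last y s'; rewrite /= lx;
      move: uc => /= /andP [/negPf ->].
  by have := mem_last z s; move: e => /= ->; move: uc => /= /and3P [_ /negPf ->].
apply/negP => /pedges_mem /(_ (set22 _ _)) xs.
by move: uc; rewrite cons_uniq xs.
Qed.

(** Sequences of length 2 are covered too, so that a single edge back to the search stack needs no
    separate treatment. *)
Definition short_cycles E L := forall c, uniq c -> cycle (adj E) c -> size c < L.

Lemma strip_long_cycles E L : 2 < L ->
  exists k F, [/\ strips k E F, k * L <= #|E| & short_cycles F L].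
Proof.
move=> L3; have [n] := ubnP #|E|; elim: n E => // n IH E ltn.
have [[c [uc cc lc]]|H] := boolp.EM (exists c, [/\ uniq c, cycle (adj E) c & L <=
  size c]).
  have c3 : 2 < size c by apply: leq_trans lc.
  have cE := cycle_adj_sub cc uc.
  have := cardsID (cycle_edges c) E;
    rewrite (setIidPr cE) card_cycle_edges // => cardE.
  have [|k [F [sF kL sh]]] := IH (E :\: cycle_edges c); first by lia.
  exists k.+1, F; split=> //; first exact: stripsS sF.
  by rewrite mulSn; lia.
exists 0, E; split=> //; first exact: strips0.
move=> c uc cc; rewrite ltnNge; apply/negP => lc; apply: H; by exists c.
Qed.

Definition inner E A := [rel u v | [&& u \in A, v \in A & adj E u v]].

(* [p] lists the stack of a depth-first search, most recent vertex first, and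
   [A] is a union of components of the complement of [p], each of them adjacent
   to the most recent vertex. *)
Definition dfs_state E V p A :=
  [/\ uniq p /\ sorted (adj E) p, A \subset V, [disjoint A & p],
      forall a v, a \in A -> adj E a v -> (v \in A) || (v \in p) &
      forall x p', p = x :: p' -> forall a, a \in A ->
        exists2 b, b \in A & adj E b x /\ connect (inner E A) a b].

Lemma inner_sym E A : symmetric (inner E A).
Proof. by move=> u v /=; rewrite adjC andbCA. Qed.

Lemma connect_inner_sub E A A' u v :
  (forall a b, a \in A' -> b \in A -> adj E a b -> b \in A') ->
  u \in A' -> connect (inner E A) u v -> v \in A' /\ connect (inner E A') u v.
Proof.
move=> cl uA /connectP [s ps ->] {v}.
elim: s u uA ps => [|w s IH] u uA //= /andP [/and3P [_ wA auw] ps].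
have wA' : w \in A' by apply: cl auw.
have [lA cA] := IH w wA' ps; split=> //; apply: connect_trans cA.
by apply: connect1; rewrite /= uA wA'.
Qed.

Lemma dfs_state_sub E V p A A' : dfs_state E V p A -> A' \subset A ->
  (forall a b, a \in A' -> b \in A -> adj E a b -> b \in A') -> dfs_state E V p A'.
Proof.
move=> [up AV dAp clA cA] /subsetP sA cl; split=> //.
- by apply: subset_trans AV; apply/subsetP.
- by apply: disjointWl dAp; apply/subsetP.
- move=> a v aA' aav; have /orP [vA|->] := clA a v (sA _ aA') aav;
    last by rewrite orbT.
  by rewrite (cl a v).
move=> x p' def_p a aA'; have [b bA [abx cab]] := cA x p' def_p a (sA _ aA').
by have [bA' c'] := connect_inner_sub cl aA' cab; exists b.
Qed.

(** On a simple path inside [A] from [a] to [r], the vertex just before [r] is adjacent to [r] and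
    is reached without using [r]. *)
Lemma dfs_state_push E V p A r : dfs_state E V p A -> r \in A ->
  (forall a, a \in A -> connect (inner E A) a r) ->
  (forall x p', p = x :: p' -> adj E r x) -> dfs_state E V (r :: p) (A :\ r).
Proof.
move=> [[up sp] AV dAp clA cA] rA conn rx; split.
- split; first by rewrite /= up andbT (disjointFr dAp).
  by case def_p: p sp => [|x p'] //= ->; rewrite (rx x p').
- by apply: subset_trans AV; apply: subsetDl.
- rewrite disjoint_sym disjoint_cons !inE eqxx /= disjoint_sym.
  by apply: disjointWl dAp; apply: subsetDl.
- move=> a v /setD1P [nar aA] /(clA a v aA); rewrite !inE.
  by case: eqVneq => //= _ /orP [->|->]; rewrite ?orbT.
move=> x p' [<- _] a /setD1P [nar aA].
have /connectP [s0 ps0 def_r] := conn a aA.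
case/shortenP: ps0 def_r => s ps us _ def_r {s0}.
case: (lastP s) def_r ps us => [ra|s' z]; first by rewrite ra eqxx in nar.
rewrite last_rcons => <- {z}.
elim: s' a aA nar => [|w s' IH] a aA nar /=.
  case/andP=> /and3P [_ _ aar] _ _; exists a; first by rewrite !inE nar.
  by split=> //; apply: connect0.
case/andP=> /and3P [_ wA aaw] ps /andP [_ us].
have nwr : w != r by move: us; rewrite /= mem_rcons inE => /andP [/norP []].
have [b bA [abr cwb]] := IH w wA nwr ps us; exists b => //; split=> //.
by apply: connect_trans cwb; apply: connect1; rewrite /= !inE nar aA nwr wA.
Qed.

(** A path in [A] from [a] to a neighbour of the top of the stack, the stack down to [v], and the
    edge back to [a] form a cycle longer than the depth of [v]. *)
Lemma dfs_state_nbr E V p A L a v : short_cycles E L -> dfs_state E V p A ->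
  a \in A -> adj E a v -> v \notin A -> v \in take L p.
Proof.
move=> sh [[up sp] AV dAp clA cA] aA aav vA.
have := clA a v aA aav; rewrite (negPf vA) /= => vp.
have [x [p' def_p]] : exists x p', p = x :: p' by case: (p) vp => // x p';
  exists x, p'.
have [b bA [abx /connectP [s0 ps0 def_b]]] := cA x p' def_p a aA.
case/shortenP: ps0 def_b => s ps us _ def_b {s0}.
have sA : {subset a :: s <= A}.
  move=> w; rewrite inE => /orP [/eqP -> //|].
  elim: (s) (a) ps => // w' s' IH a' /= /andP [/and3P [_ w'A _] /IH H].
  by rewrite inE => /orP [/eqP ->|/H].
rewrite in_take //; set i := index v p.
have [t def_q] : exists t, take i.+1 p = x :: t by rewrite def_p /=;
  exists (take i p').
have lt_v : last x t = v.
  by have := congr1 (last x) def_q;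
    rewrite (take_nth x) ?index_mem // last_rcons nth_index.
have szq : size (x :: t) = i.+1 by rewrite -def_q size_takel // index_mem.
apply: leq_ltn_trans (sh (a :: s ++ x :: t) _ _).
- by rewrite [size _]/= size_cat szq addnS -!addSn leq_addl.
- rewrite -cat_cons -def_q cat_uniq us take_uniq // andbT.
  apply/hasPn => w /mem_take wp; apply/negP => /sA wA.
  by rewrite (disjointFr dAp wA) in wp.
rewrite /= rcons_cat cat_path; apply/andP; split.
  by apply: sub_path ps => u w /and3P [].
rewrite -def_b /= abx rcons_path lt_v adjC aav andbT.
by have := take_sorted i.+1 sp; rewrite def_q.
Qed.

(** The search starts from [A = V] and goes on until [A] has at most 2L vertices, never letting it
    drop below L. By [dfs_state_nbr] the outside neighbours of [A] are then among the top L stack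
    vertices. *)
Lemma small_separator E V L : 0 < L -> short_cycles E L -> L <= #|V| -> within E V ->
  exists B, [/\ B \subset V, L <= #|B| <= 2 * L &
    #|[set v | (v \notin B) && [exists u in B, adj E u v]]| <= L].
Proof.
move=> L0 sh LV wE.
suff H n p A : #|A| < n -> L <= #|A| -> dfs_state E V p A -> exists B, [/\ B \subset
  V,
    L <= #|B| <= 2 * L & #|[set v | (v \notin B) && [exists u in B, adj E u v]]| <=
      L].
  apply: (H _ [::] V (ltnSn _)) => //; split=> //.
  - by rewrite disjoint_sym disjoint0.
  - by move=> a v _ /(within_adj wE) [_ ->].
elim: n p A => // n IH p A ltn LA st.
have [A2L|A2L] := leqP #|A| (2 * L).
  exists A; split; rewrite ?LA //; first by case: st.
  apply: leq_trans (_ : #|[set v in take L p]| <= L).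
    apply/subset_leq_card/subsetP => v;
      rewrite !inE => /andP [vA /existsP [u /andP [uA auv]]].
    exact: (dfs_state_nbr sh st uA auv vA).
  rewrite cardsE; apply: leq_trans (card_size _) _.
  by rewrite size_take_min geq_minl.
have [r rA rp] : exists2 r, r \in A & forall x p', p = x :: p' -> adj E r x.
  have [a aA] : exists a, a \in A by apply/set0Pn; rewrite -card_gt0; lia.
  case: st => _ _ _ _; case: (p) => [|x p'] H; first by exists a.
  by have [b bA [bx _]] := H x p' (erefl _) a aA; exists b => // _ _ [<- _].
pose A1 := [set v in A | connect (inner E A) r v].
have sA1 : A1 \subset A by apply/subsetP => v; rewrite inE => /andP [].
have cl1 a b : a \in A -> b \in A -> adj E a b -> (a \in A1) = (b \in A1).
  move=> aA bA ab; rewrite !inE aA bA /=; have cab : connect (inner E A) a b.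
    by apply: connect1; rewrite /= aA bA.
  exact: (same_connect_r (sym_connect_sym (inner_sym E A)) cab r).
(* If [A] is connected, [r] is pushed. Otherwise one keeps the component [A1] of [r] when it has at
   least L vertices, and else the rest, which has more than L because [A] has more than 2L. *)
have [A1A|A1A] := eqVneq A1 A.
  apply: (IH (r :: p) (A :\ r)).
  - by move: ltn; rewrite (cardsD1 r A) rA.
  - by move: A2L; rewrite (cardsD1 r A) rA; lia.
  - apply: dfs_state_push => // a; rewrite -{1}A1A inE => /andP [_].
    by rewrite (sym_connect_sym (inner_sym E A)).
have cA1 : #|A1| < #|A| by rewrite proper_card // properEneq A1A.
have := cardsID A1 A; rewrite (setIidPr sA1) => cardA.
have rA1 : r \in A1 by rewrite inE rA connect0.
have A1gt0 : 0 < #|A1| by rewrite card_gt0; apply/set0Pn; exists r.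
have [LA1|LA1] := leqP L #|A1|.
  apply: (IH p A1) => //; first by lia.
  apply: (dfs_state_sub st sA1) => a b aA1 bA ab.
  by rewrite -(cl1 a b) // (subsetP sA1).
apply: (IH p (A :\: A1)); [lia|lia|].
apply: (dfs_state_sub st (subsetDl _ _)) => a b /setDP [aA aA1] bA ab.
by rewrite inE bA -(cl1 a b) // aA1.
Qed.

End LongCycles.

(** * Reduction to pieces with few vertices *)

Section Pieces.
Variable T : finType.
Implicit Types (x y u v a b r : T) (s c p : seq T) (f : {set T}) (E F G : {set {set
  T}}).
Implicit Types (X A B V S W H : {set T}).

Definition reducible k m E := exists j F, [/\ strips j E F, j <= k & #|F| <= m].

Lemma reducible_leq k1 m1 k2 m2 E :
  k1 <= k2 -> m1 <= m2 -> reducible k1 m1 E -> reducible k2 m2 E.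
Proof.
move=> k12 m12 [j [F [sF jk Fm]]]; exists j, F; split=> //.
  exact: leq_trans k12.
exact: leq_trans m12.
Qed.

Lemma reducible_self m E : #|E| <= m -> reducible 0 m E.
Proof. by move=> Em; exists 0, E; split=> //; exact: strips0. Qed.

Lemma reducibleU k1 m1 k2 m2 E1 E2 : [disjoint E1 & E2] ->
  reducible k1 m1 E1 -> reducible k2 m2 E2 ->
  reducible (k1 + k2) (m1 + m2) (E1 :|: E2).
Proof.
move=> d12 [j1 [F1 [s1 jk1 Fm1]]] [j2 [F2 [s2 jk2 Fm2]]].
exists (j1 + j2), (F1 :|: F2); split; first exact: strips_disjointU.
  exact: leq_add.
by apply: leq_trans (leq_card_setU _ _) _; apply: leq_add.
Qed.

Lemma reducible_split k1 m1 k2 m2 E F : F \subset E ->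
  reducible k1 m1 F -> reducible k2 m2 (E :\: F) ->
  reducible (k1 + k2) (m1 + m2) E.
Proof.
move=> FE r1 r2; rewrite -(setID E F) (setIidPr FE); apply: reducibleU => //.
by rewrite disjoint_sym disjoints_subset subsetDr.
Qed.

Lemma short_cycles_sub E F L : F \subset E -> short_cycles E L -> short_cycles F L.
Proof.
by move=> FE sh c uc cc; apply: sh => //; apply: sub_cycle cc; apply: adj_sub.
Qed.

Lemma touching_within E V B : within E V -> simple E -> B \subset V ->
  within (touching E B) (B :|: [set v | (v \notin B) && [exists u in B, adj E u v]]).
Proof.
move=> wE sE BV f; rewrite inE => /andP [fE]; case/pred0Pn => u /andP [/= uf uB].
apply/subsetP => v vf; rewrite !inE; case vB: (v \in B) => //=.
apply/existsP; exists u; rewrite uB /=.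
have [x [y [nxy def_f axy]]] := simple_edge sE fE; move: uf vf; rewrite def_f !inE.
case/orP => /eqP eu /orP [] /eqP ev; subst u v; rewrite ?uB // in vB *.
by rewrite adjC.
Qed.

Lemma untouched_within E V B : within E V -> within (E :\: touching E B) (V :\: B).
Proof.
move=> wE f /setDP [fE]; rewrite inE fE /= negbK => dfB.
by rewrite subsetD wE.
Qed.

(** The edges at a separated set [B] live on [B] and its at most L neighbours, hence on at most 2|B|
    vertices because |B| is at least L. Removing [B] and repeating gives pieces with at most 2|V|
    vertices in total. *)
Lemma short_cycles_reducible (L a m : nat) : 0 < L ->
  (forall E X, simple E -> within E X -> #|X| <= 3 * L -> reducible (a * #|X|) (m *
    #|X|) E) ->
  forall E V, simple E -> within E V -> short_cycles E L ->
  reducible (2 * a * #|V|) (2 * m * #|V|) E.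
Proof.
move=> L0 small E V; have [n] := ubnP #|V|; elim: n E V => // n IH E V ltn sE wE sh.
have [V3|V3] := leqP #|V| (3 * L).
  by apply: reducible_leq (small E V sE wE V3); rewrite -mulnA leq_pmull.
have LV : L <= #|V| by lia.
have [B [BV /andP [LB BL] NB]] := small_separator L0 sh LV wE.
set N := [set v | _] in NB.
have cX : #|B :|: N| <= 2 * #|B|.
  by apply: leq_trans (leq_card_setU _ _) _; lia.
have cX3 : #|B :|: N| <= 3 * L.
  by apply: leq_trans (leq_card_setU _ _) _; rewrite mulSnr leq_add.
have sub : touching E B \subset E by apply/subsetP => f; rewrite inE => /andP [].
have cV : #|V :\: B| + #|B| = #|V| by rewrite addnC -(cardsID B V) (setIidPr BV).
have r1 : reducible (2 * a * #|B|) (2 * m * #|B|) (touching E B).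
  apply: reducible_leq (small _ _ (simpleS sub sE) (touching_within wE sE BV) _).
  - by rewrite (mulnC 2) -mulnA leq_mul2l cX orbT.
  - by rewrite (mulnC 2) -mulnA leq_mul2l cX orbT.
  - exact: cX3.
have sD : E :\: touching E B \subset E := subsetDl _ _.
have r2 := IH _ (V :\: B) _ (simpleS sD sE) (untouched_within wE) (short_cycles_sub
  sD sh).
apply: reducible_leq (reducible_split sub r1 (r2 _)); [..|by lia];
  by rewrite -cV -mulnDr addnC.
Qed.

(** * Hitting sets and levels *)

(** A factor 1 - 1/Q per step is at most 1/2 after Q steps; in natural numbers this is derived from
    the bound Q/(Q + k) for k steps. *)
Lemma decay (Q l : nat) (a : nat -> nat) : 0 < Q ->
  (forall i, Q * a i.+1 + a i <= Q * a i) -> a (Q * l) * 2 ^ l <= a 0.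
Proof.
move=> Q0 step.
have mono i : a i.+1 <= a i.
  by rewrite -(leq_pmul2l Q0); apply: leq_trans (step i); apply: leq_addr.
have half i : 2 * a (i + Q) <= a i.
  have H k : (Q + k) * a (i + k) <= Q * a i.
    elim: k => [|k IH]; first by rewrite !addn0.
    apply: leq_trans IH; rewrite addnS.
    apply: leq_trans (_ : Q * a (i + k).+1 + k.+1 * a (i + k) <= _).
      by rewrite addnS -addSn addSnnS mulnDl leq_add2l leq_mul2l mono orbT.
    by rewrite mulSn addnA mulnDl leq_add2r.
  by have := H Q; rewrite addnn -mul2n -mulnA mulnCA leq_pmul2l.
elim: l => [|l IH]; first by rewrite muln0 muln1.
apply: leq_trans IH; rewrite expnS mulnA (mulnC _ 2) mulnS addnC leq_mul2r.
by rewrite half orbT.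
Qed.

(** Double counting of the incidences between points and sets: an average point of [X] lies in a
    fraction 1/Q of the sets. *)
Lemma greedy_hit Q X (Fam : {set {set T}}) : Fam != set0 ->
  (forall A, A \in Fam -> [/\ A \subset X, A != set0 & #|X| <= Q * #|A|]) ->
  exists2 x, x \in X & #|Fam| <= Q * #|[set A in Fam | x \in A]|.
Proof.
move=> Fn0 HF.
have [A0 A0F] := set0Pn _ Fn0.
have [/subsetP A0X /set0Pn [x0 /A0X x0X] _] := HF A0 A0F.
case: (pickP [pred x in X | #|Fam| <= Q * #|[set A in Fam | x \in A]|]) => [x /andP
  [? ?]|H].
  by exists x.
have lt x : x \in X -> Q * #|[set A in Fam | x \in A]| < #|Fam|.
  by move=> xX; have := H x; rewrite /= xX /= ltnNge => ->.
suff : #|X| * #|Fam| < #|X| * #|Fam| by rewrite ltnn.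
apply: (@leq_ltn_trans (\sum_(x in X) Q * #|[set A in Fam | x \in A]|)).
  rewrite mulnC -sum_nat_const -big_distrr /=.
  apply: (@leq_trans (\sum_(A in Fam) Q * #|A|)).
    by apply: leq_sum => A /HF [].
  rewrite -big_distrr leq_mul2l; apply/orP; right.
  have -> : \sum_(A in Fam) #|A| = \sum_(A in Fam) \sum_(x in X) (x \in A : nat).
    apply: eq_bigr => A /HF [/setIidPr sAX _ _].
    rewrite -sAX -sum1_card big_mkcond [RHS]big_mkcond /=.
    by apply: eq_bigr => x _; rewrite inE; do 2!case: (_ \in _).
  rewrite exchange_big /=; apply: leq_sum => x _.
  rewrite -sum1_card big_mkcond [leqRHS]big_mkcond /=; apply: leq_sum => A _.
  by rewrite inE; do 2!case: (_ \in _).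
rewrite -sum_nat_const (bigD1 x0) //= [ltnRHS](bigD1 x0) //= -addSn.
by apply: leq_add; [exact: lt | apply: leq_sum => x /andP [/lt /ltnW]].
Qed.

(** Q greedy choices at least halve the number of missed sets, and l halvings exhaust fewer than 2^l
    of them. *)
Lemma hitting_set Q l X (Fam : {set {set T}}) : 0 < Q -> #|Fam| < 2 ^ l ->
  (forall A, A \in Fam -> [/\ A \subset X, A != set0 & #|X| <= Q * #|A|]) ->
  exists H, [/\ H \subset X, #|H| <= Q * l & forall A, A \in Fam -> ~~ [disjoint A &
    H]].
Proof.
move=> Q0.
have half k (G : {set {set T}}) :
    (forall A, A \in G -> [/\ A \subset X, A != set0 & #|X| <= Q * #|A|]) ->
    exists H, [/\ H \subset X, #|H| <= k &
      (Q + k) * #|[set A in G | [disjoint A & H]]| <= Q * #|G|].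
  move=> HG; elim: k => [|k [H [HX Hk HQ]]].
    exists set0; rewrite sub0set cards0 addn0 leq_mul2l; split=> //.
    apply/orP; right; apply: subset_leq_card; apply/subsetP => A.
    by rewrite inE => /andP [].
  set G1 := [set A in G | _] in HQ.
  have [G10|G1n] := eqVneq G1 set0.
    exists H; split=> //; first exact: leqW.
    by rewrite -/G1 G10 cards0 muln0.
  have [|x xX xG] := @greedy_hit Q X G1 G1n.
    by move=> A; rewrite inE => /andP [/HG].
  exists (x |: H); split.
  - by rewrite subUset sub1set xX.
  - by rewrite cardsU1; case: (x \in H) => //=; apply: leqW.
  set G2 := [set A in G | _].
  have : #|G2| + #|[set A in G1 | x \in A]| <= #|G1|.
    rewrite -(cardsID [set A : {set T} | x \in A] G1) addnC leq_add //.
      by apply: subset_leq_card; apply/subsetP => A; rewrite !inE.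
    apply: subset_leq_card; apply/subsetP => A.
    rewrite !inE => /andP [-> ]; rewrite disjoint_sym disjoints_subset subUset
      sub1set inE -disjoints_subset => /andP [-> ].
    by rewrite disjoint_sym => ->.
  move: (#|_|) (#|_|) (#|_|) (#|_|) HQ xG; clear; nia.
elim: l Fam => [|l IH] Fam ltF HF.
  exists set0; rewrite sub0set cards0; split=> // A AF.
  by move: ltF; rewrite (cardsD1 A) AF.
have [H1 [H1X H1Q]] := half Q Fam HF; set G := [set A in _ | _] => HG.
have [|A|H2 [H2X H2l H2G]] := IH G.
- by move: ltF HG; rewrite expnS addnn -mul2n -mulnA mulnCA leq_pmul2l //; lia.
- by rewrite inE => /andP [/HF].
exists (H1 :|: H2); split.
- by rewrite subUset H1X.
- by apply: leq_trans (leq_card_setU _ _) _; rewrite mulnS leq_add.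
move=> A AF; rewrite disjoint_sym disjoints_subset subUset -!disjoints_subset
  negb_and.
by rewrite ![ [disjoint _ & A]]disjoint_sym; case dA: [disjoint A & H1] => //=;
  apply: H2G; rewrite inE AF.
Qed.

(** Hitting sets are chosen k times, each time for the sets minus the points chosen before. The
    subtracted term [k * (Q * l)] pays for these points. *)
Lemma multi_hitting_set k Q l X (Fam : {set {set T}}) : 0 < Q -> #|Fam| < 2 ^ l ->
  (forall A, A \in Fam -> [/\ A \subset X, k * (Q * l) < #|A| &
     #|X| <= Q * (#|A| - k * (Q * l))]) ->
  exists W, [/\ W \subset X, #|W| <= k * (Q * l) &
    forall A, A \in Fam -> k <= #|A :&: W|].
Proof.
move=> Q0 ltF; elim: k => [|k IH] HF.
  by exists set0; rewrite sub0set cards0.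
have [|W [WX cW HW]] := IH.
  move=> A /HF [AX lA XA]; split=> //; first by apply: leq_ltn_trans lA;
    rewrite leq_mul2r leqnSn orbT.
  by apply: leq_trans XA _; rewrite leq_mul2l; apply/orP; right;
    rewrite leq_sub2l // leq_mul2r leqnSn orbT.
have [||H [HX cH hit]] := @hitting_set Q l X [set A :\: W | A in Fam] Q0.
- exact: leq_ltn_trans (leq_imset_card _ _) ltF.
- move=> _ /imsetP [A AF ->]; have [AX lA XA] := HF A AF.
  have : #|A| - k.+1 * (Q * l) <= #|A :\: W|.
    rewrite cardsD leq_sub2l //; apply: leq_trans (subset_leq_card (subsetIr _ _)) _.
    by apply: leq_trans cW _; rewrite leq_mul2r leqnSn orbT.
  move=> le; split; first exact: subset_trans (subsetDl _ _) AX.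
    by rewrite -card_gt0; apply: leq_trans le; rewrite subn_gt0.
  by apply: leq_trans XA _; rewrite leq_mul2l le orbT.
exists (W :|: H); split.
- by rewrite subUset WX.
- by apply: leq_trans (leq_card_setU _ _) _; rewrite mulSn addnC leq_add.
move=> A AF; have := hit _ (imset_f _ AF);
  case/pred0Pn => x /andP [/= /setDP [xA xW] xH].
apply: leq_trans (_ : #|x |: (A :&: W)| <= _).
  by rewrite cardsU1 inE (negPf xW) andbF ltnS HW.
apply: subset_leq_card; rewrite subUset sub1set !inE xA xH orbT /=.
by apply: setIS; apply: subsetUl.
Qed.

(** The sum counts the edges between [S] and [X :\: S]: every cut has density at least 1/q. *)
Definition expands E X q := forall S, S \subset X ->
  #|S| * #|X :\: S| <= q * \sum_(v in X :\: S) #|nb E v :&: S|.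

(** The threshold [h] guarantees many choices at each step of a descent towards [x], so that some
    choice avoids used edges. *)
Fixpoint level E X h x i : {set T} :=
  if i is i'.+1 then
    level E X h x i' :|: [set v in X | h <= #|nb E v :&: level E X h x i'|]
  else nb E x.

Lemma nb_sub E X v : within E X -> nb E v \subset X.
Proof. by move=> wE; apply/subsetP => u; rewrite inE => /(within_adj wE) []. Qed.

Lemma level_sub E X h x i : within E X -> level E X h x i \subset X.
Proof.
move=> wE; elim: i => [|i IH] /=; first exact: nb_sub.
by rewrite subUset IH /=; apply/subsetP => v; rewrite inE => /andP [].
Qed.

Lemma expands_nb E X q x : within E X -> expands E X q -> x \in X ->
  #|X|.-1 <= q * #|nb E x|.
Proof.
move=> wE ex xX; have := ex (X :\ x) (subsetDl _ _).
have -> : X :\: (X :\ x) = [set x].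
  by apply/setP => y; rewrite !inE; case: eqVneq => [->|_] //=; case: (y \in X).
rewrite cards1 muln1 big_set1 (cardsD1 x X) xX add1n => le; apply: leq_trans le _.
by rewrite leq_mul2l subset_leq_card ?orbT // subsetIl.
Qed.

(** Each level [B] has at least 2qh vertices. Outside vertices with fewer than [h] neighbours in [B]
    thus account for at most half of the edges that expansion forces across the cut, so a fraction
    1/(2q) of the outside joins the next level. By [decay], the outside is empty after 2ql steps. *)
Lemma level_full E X q h l x : within E X -> expands E X q -> 0 < q ->
  1 < #|X| -> 4 * q * q * h <= #|X| -> #|X| < 2 ^ l -> x \in X ->
  level E X h x (2 * q * l) = X.
Proof.
move=> wE ex q0 X2 hX Xl xX.
have dx := expands_nb wE ex xX.
have hB i : 0 < #|level E X h x i| /\ 2 * q * h <= #|level E X h x i|.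
  have le0 : #|nb E x| <= #|level E X h x i|.
    apply: subset_leq_card; elim: i => //= i IH.
    by apply: subset_trans IH _; apply: subsetUl.
  move: (#|nb E x|) (#|level _ _ _ _ _|) le0 dx hX X2 q0; move: #|X|; clear; nia.
pose a i := #|X :\: level E X h x i|.
have step i : 2 * q * a i.+1 + a i <= 2 * q * a i.
  rewrite /a; set B := level E X h x i; set N := level E X h x i.+1.
  have [B0 B1] := hB i; rewrite -/B in B0 B1.
  have BX : B \subset X by apply: level_sub.
  have BN : B \subset N by apply: subsetUl.
  have := ex B BX.
  have cD : #|X :\: B| = #|(X :\: B) :&: N| + #|X :\: N|.
    by rewrite -(cardsID N (X :\: B)) setDDl (setUidPr BN).
  have le : \sum_(v in X :\: B) #|nb E v :&: B| <= #|(X :\: B) :&: N| * #|B| + #|X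
    :\: B| * h.
    rewrite -!sum_nat_const.
    rewrite (eq_bigl (fun v => (v \in X :\: B) && (v \in N)) (fun=> #|B|));
      last first.
      by move=> v; rewrite inE.
    rewrite big_mkcondr /= -big_split /=; apply: leq_sum => v vXB.
    case: ifP => vN; first by apply: leq_trans (leq_addr _ _);
      apply: subset_leq_card; apply: subsetIr.
    rewrite add0n leqNgt; apply/negP => /ltnW hv; case/negP: vN.
    by move: vXB; rewrite !inE => /andP [_ ->]; rewrite -/B hv orbT.
  move: (\sum_(_ in _) _) le cD B0 B1 => sm.
  move: #|X :\: B| #|X :\: N| #|_ :&: N| #|B| => d d' e b; clear; nia.
have := @decay (2 * q) l a _ step; rewrite muln_gt0 q0 => /(_ isT).
have : a 0 < 2 ^ l.
  by apply: leq_ltn_trans Xl; apply: subset_leq_card; apply: subsetDl.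
move=> lt le; apply/eqP; rewrite eqEsubset level_sub //= -setD_eq0 -cards_eq0 -/(a _).
by move: (a _) le (leq_ltn_trans le lt) => n _; case: n => // n;
  rewrite mulSn ltnNge leq_addr.
Qed.

End Pieces.

(** * Dense graphs *)

Section Clusters.
Variable T : finType.
Implicit Types (x y u v a b r : T) (s p w : seq T) (f : {set T}) (E F G U : {set
  {set T}}).
Implicit Types (X A B V S W H : {set T}).

Lemma sum_deg U : simple U -> \sum_v deg U v = 2 * #|U|.
Proof.
move=> sU; transitivity (\sum_(f in U) \sum_(v : T) (v \in f : nat)).
  rewrite exchange_big /=; apply: eq_bigr => v _.
  rewrite /deg -sum1_card big_mkcond [RHS]big_mkcond /=; apply: eq_bigr => f _.
  by rewrite inE; do 2!case: (_ \in _).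
rewrite mulnC -sum_nat_const; apply: eq_bigr => f /sU <-.
by rewrite -sum1_card [RHS]big_mkcond /=; apply: eq_bigr => v _; case: (_ \in _).
Qed.

(** Markov's inequality for the degrees, whose sum is 2|U|. *)
Lemma card_overused U c o : simple U -> 0 < c -> 2 * #|U| <= o * c ->
  #|[set v | c < deg U v]| <= o.
Proof.
move=> sU c0 le; rewrite -(leq_pmul2r c0); apply: leq_trans le.
rewrite -sum_deg // -sum_nat_const big_mkcond /=; apply: leq_sum => v _.
by rewrite inE; case: ifP => // /ltnW.
Qed.

Lemma card_used_nbrs U v : #|[set u | [set v; u] \in U]| <= deg U v.
Proof.
have inj : injective (fun u => [set v; u]) by move=> u u' /set2_injr.
rewrite -(card_imset _ inj); apply: subset_leq_card.
by apply/subsetP => f /imsetP [u]; rewrite !inE => uU ->; rewrite uU !inE eqxx.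
Qed.

(** At most [o] candidates are overused, and at most [c] are lost to used edges at each of [v] and
    [x]. The edge to [x] is kept free because the descent may end with it. *)
Lemma unused_candidate U A x v c o k : #|[set u | c < deg U u]| <= o ->
  deg U v <= c -> deg U x <= c -> o + 2 * c < k -> k <= #|A| ->
  exists u, [/\ u \in A, deg U u <= c, [set v; u] \notin U & [set x; u] \notin U].
Proof.
move=> co dv dx ok kA.
pose bad := [set u | c < deg U u] :|: ([set u | [set v;
  u] \in U] :|: [set u | [set x; u] \in U]).
have cbad : #|bad| < #|A|.
  apply: leq_trans kA; apply: leq_ltn_trans ok.
  apply: leq_trans (leq_card_setU _ _) _; apply: leq_add => //.
  apply: leq_trans (leq_card_setU _ _) _; rewrite mul2n -addnn.
  by apply: leq_add; apply: leq_trans (card_used_nbrs _ _) _.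
have [u uA] : exists2 u, u \in A & u \notin bad.
  by apply/subsetPn; apply: contraL cbad => /subset_leq_card; rewrite leqNgt.
rewrite !inE !negb_or -leqNgt => /and3P [? ? ?]; by exists u.
Qed.

(** * Closing paths into cycles through a hitting set *)

Section Connecting.
Variables (E : {set {set T}}) (X W : {set T}) (h t k : nat).
Hypotheses (wE : within E X) (WX : W \subset X).
Hypothesis full : forall x, x \in X -> level E X h x t = X.
Hypothesis rich : forall v, v \in X -> h <= #|nb E v|.
Hypothesis hits : forall x v i, x \in X -> v \in X -> i <= t ->
  h <= #|nb E v :&: level E X h x i| -> k <= #|nb E v :&: level E X h x i :&: W|.

Section OneConnection.
Variables (U : {set {set T}}) (c o : nat) (x : T).
Hypotheses (xX : x \in X) (dx : deg U x <= c) (few : #|[set u | c < deg U u]| <= o).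
Hypothesis ok : o + 2 * c < k.

(** Induction on the level. A vertex new at level i + 1 has at least [h] neighbours in level i,
    hence [k] of them in [W], and one is usable. No vertex repeats, since the rest of the path stays
    in level i. *)
Lemma descend i v : i <= t -> v \in level E X h x i -> v \in W ->
  deg U v <= c -> [set x; v] \notin U ->
  exists p, [/\ path (adj (E :\: U)) v p, uniq (v :: p),
    {subset v :: p <= W :&: level E X h x i}, adj (E :\: U) (last v p) x & size p <=
      i].
Proof.
elim: i v => [|i IH] v it vi vW dv xv.
  exists [::]; split=> //.
    by move=> u; rewrite !inE => /eqP ->; rewrite vW; move: vi; rewrite /= inE.
  by rewrite adjC /adj inE xv; move: vi; rewrite /= inE.
have [vi'|vi'] := boolP (v \in level E X h x i).
  have [p [pp up sp lp szp]] := IH v (ltnW it) vi' vW dv xv.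
  exists p; split=> //; last exact: leqW.
  by move=> u /sp; rewrite !in_setI => /andP [-> ui]; rewrite /= in_setU ui.
move: vi; rewrite /= inE (negPf vi') inE => /andP [vX hv].
have [u [uA du vu xu]] := unused_candidate few dv dx ok (hits xX vX (ltnW it) hv).
move: uA; rewrite !in_setI => /andP [/andP [uv ui] uW].
have [p [pp up sp lp szp]] := IH u (ltnW it) ui uW du xu.
exists (u :: p); split=> //.
- by rewrite /= pp andbT /adj inE vu; move: uv; rewrite inE.
- by apply/andP; split=> //; apply: contra vi' => /sp; rewrite inE => /andP [].
move=> z; rewrite inE => /orP [/eqP ->|/sp].
  by rewrite !in_setI vW /= !inE vX hv orbT.
by rewrite !in_setI => /andP [-> zi]; rewrite /= in_setU zi.
Qed.

(** Since level [t] is all of [X], any usable neighbour of [y] in [W] can start a descent to [x]. *)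
Lemma connection y : y \in X -> deg U y <= c ->
  exists w, [/\ path (adj (E :\: U)) y (rcons w x), uniq w, {subset w <= W},
    w != [::] & size w <= t.+1].
Proof.
move=> yX dy; have nyX : nb E y :&: level E X h x t = nb E y.
  by rewrite full //; apply/setIidPl; apply: nb_sub.
have := hits xX yX (leqnn t); rewrite nyX => /(_ (rich yX)) ky.
have [u [uA du yu xu]] := unused_candidate few dy dx ok ky.
move: uA; rewrite in_setI => /andP [uy uW].
have ut : u \in level E X h x t by rewrite full // (subsetP WX).
have [p [pp up sp lp szp]] := descend (leqnn t) ut uW du xu.
exists (u :: p); split=> //.
  by rewrite /= rcons_path pp lp /adj inE yu; move: uy; rewrite inE /adj => ->.
by move=> z /sp; rewrite inE => /andP [].
Qed.

End OneConnection.

Lemma count_pedges_endpoints v x y w : v \notin w ->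
  count (fun f : {set T} => v \in f) (pedges (y :: rcons w x)) <= (y == v) + (x == v).
Proof.
elim: w y => [|u w IH] y.
  move=> _; rewrite /= !inE addn0 !(eq_sym v).
  by case: eqP; case: eqP.
rewrite inE negb_or => /andP [nvu /(IH u)]; rewrite (eq_sym u) (negPf nvu) add0n.
by rewrite rcons_cons pedges_cons /= !inE (negPf nvu) orbF (eq_sym y) leq_add2l.
Qed.

Lemma pedges_catl x s t' : pedges (x :: s ++ t') = pedges (x :: s) ++ pedges (last x
  s :: t').
Proof. exact: pairmap_cat. Qed.

(** Induction on the paths, with [U] the edges used by earlier connections. A vertex outside [W]
    gains a used edge only when a path ending there is closed, so adding [endnum] to its degree
    keeps it from being overused. The last inequality bounds the number of overused vertices
    throughout. *)
Lemma close_paths U c o ps : simple E -> 0 < c -> o + 2 * c < k ->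
  U \subset touching E W -> all uniq ps -> all (fun s => 1 < size s) ps ->
  uniq (flatten (map (@pedges T) ps)) ->
  {subset flatten (map (@pedges T) ps) <= E :\: touching E W} ->
  (forall s v, s \in ps -> v \in s -> v \in X :\: W) ->
  (forall v, v \notin W -> deg U v + endnum ps v <= c) ->
  2 * (#|U| + size ps * t.+2) <= o * c ->
  exists2 F : {set {set T}}, F \subset touching E W &
    strips (size ps) ([set f in flatten (map (@pedges T) ps)] :|: (touching E W :\:
      U)) F.
Proof.
move=> sE c0 ok; elim: ps U => [|s ps IH] U UW.
  move=> _ _ _ _ _ _ _; exists (touching E W :\: U); first exact: subsetDl.
  have -> : [set f in flatten (map (@pedges T) [::])] = set0 by apply/setP => f;
    rewrite !inE.
  by rewrite set0U; apply: strips0.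
rewrite ![all _ (_ :: _)]/= => /andP [us ups] /andP [s2 ps2].
rewrite [flatten _]/= cat_uniq => /and3P [ues dis uflat] sub vert degs tot.
case: s us s2 ues dis sub vert degs tot => // x s us s2 ues dis sub vert degs tot.
set y := last x s; set ep := flatten _ in dis uflat sub *.
have sU : simple U.
  by apply: simpleS sE; apply: subset_trans UW _; apply/subsetP => f;
    rewrite inE => /andP [].
have ED v : endnum ((x :: s) :: ps) v = (x == v) + (y == v) + endnum ps v.
  by rewrite -(cat1s (x :: s)) endnum_cat /endnum /= addn0.
have few : #|[set u | c < deg U u]| <= o.
  by apply: (card_overused sU c0); apply: leq_trans tot;
    rewrite leq_mul2l leq_addr orbT.
have xV : x \in X :\: W by apply: (vert (x :: s)); rewrite ?mem_head.
have yV : y \in X :\: W by apply: (vert (x :: s)); rewrite ?mem_head ?mem_last.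
move: (xV) (yV); rewrite !inE => /andP [xW xX] /andP [yW yX].
have nyx : x != y.
  by move: us s2; rewrite /y; case: (s) => // z s1 /andP [nx _] _; apply/eqP => xl;
    move: nx; rewrite {1}xl /= mem_last.
have dx : deg U x <= c by apply: leq_trans (degs x xW); apply: leq_addr.
have dy : deg U y <= c by apply: leq_trans (degs y yW); apply: leq_addr.
have [w [pw uw wW wn szw]] := connection xX dx few ok yX dy.
pose conn := [set f in pedges (y :: rcons w x)].
have connE f : f \in conn -> f \in touching E W /\ f \notin U.
  rewrite inE => fw; move: pw; rewrite path_pedges => /allP /(_ _ fw) /=.
  rewrite !inE => /andP [fU ->]; split=> //=.
  (* The inner vertices of the connection are in [W] and there is at least one, so each of its edges
     meets [W]. *)
  have : all (fun g : {set T} => ~~ [disjoint g & W]) (pedges (y :: rcons w x)).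
    have hw u z : (u \in W) || (z \in W) -> ~~ [disjoint [set u; z] & W].
      case/orP => H; apply/pred0Pn; [exists u | exists z];
        by rewrite /= !inE eqxx ?orbT.
    case: (w) wW wn => // u w' wW _.
    have uW : u \in W by apply: wW; rewrite mem_head.
    have {}wW : {subset w' <= W} by move=> z zw; apply: wW; rewrite inE zw orbT.
    rewrite rcons_cons pedges_cons [all _ _]/= hw ?uW ?orbT // andTb.
    elim: w' u uW wW => [|z w' IHw] u uW wW; first by rewrite /= hw ?uW.
    rewrite [all _ _]/= hw ?uW // andTb; apply: IHw.
      by apply: wW; rewrite mem_head.
    by move=> z' zw; apply: wW; rewrite inE zw orbT.
  by move/allP/(_ _ fw).
have UW' : U :|: conn \subset touching E W.
  by rewrite subUset UW; apply/subsetP => f /connE [].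
have degs' v : v \notin W -> deg (U :|: conn) v + endnum ps v <= c.
  move=> vW; apply: leq_trans (degs v vW); rewrite ED addnA leq_add2r.
  apply: (@leq_trans (deg U v + deg conn v)).
    rewrite /deg; apply: leq_trans (leq_card_setU _ _); apply: subset_leq_card.
    by apply/subsetP => f; rewrite !inE andb_orl.
  rewrite leq_add2l addnC; apply: leq_trans (count_pedges_endpoints (w := w) _ _ _).
    rewrite -size_filter; apply: leq_trans (card_size _); apply: subset_leq_card.
    by apply/subsetP => f; rewrite !inE mem_filter andbC.
  by apply: contra vW => /wW.
(* At most [t.+1] inner vertices mean at most [t.+2] edges. *)
have tot' : 2 * (#|U :|: conn| + size ps * t.+2) <= o * c.
  apply: leq_trans tot; rewrite leq_mul2l /= mulSn addnA leq_add2r.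
  apply: leq_trans (leq_card_setU _ _) _; rewrite leq_add2l /conn cardsE.
  by apply: leq_trans (card_size _) _; rewrite size_pedges /= size_rcons.
have sub' : {subset ep <= E :\: touching E W}.
  by move=> f fe; apply: sub; rewrite mem_cat fe orbT.
have vert' s1 v : s1 \in ps -> v \in s1 -> v \in X :\: W.
  by move=> s1p; apply: vert; rewrite inE s1p orbT.
have [F FW st] := IH _ UW' ups ps2 uflat sub' vert' degs' tot'.
(* The path avoids [W] and the connection has its inner vertices in [W]. *)
have uc : uniq (x :: s ++ w).
  rewrite -cat_cons cat_uniq us uw andbT /=; apply/hasPn => z /wW zW;
    apply/negP => zs.
  by have := vert (x :: s) z (mem_head _ _) zs; rewrite inE zW.
have ce f : (f \in cycle_edges (x :: s ++ w)) = (f \in pedges (x :: s)) || (f \in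
  conn).
  by rewrite mem_cycle_edges // rcons_cat pedges_catl mem_cat inE.
exists F => //; apply: (@stripsS _ _ (x :: s ++ w)) => //.
- by move: s2 wn; rewrite /= size_cat; case: (w) => // z w'; case: (s) => //= ? ?;
    rewrite addnS.
- rewrite /= path_pedges; apply/allP => f; rewrite -(mem_cycle_edges _ uc) ce.
  rewrite /= in_setU in_set mem_cat => /orP [-> //|/connE [fW fU]].
  by rewrite in_setD fU fW orbT.
suff -> : ([set f in pedges (x :: s) ++ ep] :|: touching E W :\: U) :\: cycle_edges
  (x :: s ++ w)
  = [set f in ep] :|: touching E W :\: (U :|: conn) by [].
apply/setP => f; rewrite in_setD ce !in_setU !in_setD !in_setU.
have := connE f; rewrite ![f \in [set _ in _] ]in_set mem_cat.
have H1 : f \in pedges (x :: s) -> f \in ep = false.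
  by move=> fs; apply/negP => /(hasPn dis) /negP; apply.
have H2 : (f \in pedges (x :: s)) || (f \in ep) -> f \in touching E W = false.
  by rewrite -mem_cat => /sub /setDP [_ /negPf].
move: H1 H2; case: (f \in pedges (x :: s)); case: (f \in ep); case: (f \in pedges _);
  case: (f \in U); case: (f \in touching E W) => //= H1 H2 H3;
    do 1?[by have := H1 isT |
  by have := H2 isT | by case: (H3 isT)].
Qed.

End Connecting.
End Clusters.

(** * Decomposing expanding clusters *)

Section Rounds.
Variable T : finType.
Implicit Types (x y u v : T) (f : {set T}) (E F G U : {set {set T}}).
Implicit Types (X A B V S W H : {set T}).

Lemma card_touching E X W : simple E -> within E X -> #|touching E W| <= #|W| * #|X|.
Proof.
move=> sE wE; rewrite -cardsX.
apply: leq_trans (leq_imset_card (fun p => [set p.1; p.2]) _).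
apply: subset_leq_card; apply/subsetP => f; rewrite inE => /andP [fE].
case/pred0Pn => u /andP [/= uf uW].
have [x [y [_ def_f axy]]] := simple_edge sE fE.
have [xX yX] := within_adj wE axy.
move: uf; rewrite def_f !inE => /orP [] /eqP uu; subst u.
  by apply/imsetP; exists (x, y); rewrite // inE uW.
by apply/imsetP; exists (y, x); rewrite ?inE ?uW // setUC.
Qed.

Lemma card_edges E X : simple E -> within E X -> #|E| <= #|X| * #|X|.
Proof.
move=> sE wE; apply: leq_trans (card_touching X sE wE); apply: subset_leq_card.
apply/subsetP => f fE; rewrite inE fE;
  have [x [y [_ def_f axy]]] := simple_edge sE fE.
have [xX _] := within_adj wE axy.
by apply/pred0Pn; exists x; rewrite /= xX def_f !inE eqxx.
Qed.

(* [h] is the threshold defining the levels and [K] bounds the size of the set [W]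
   that meets every relevant neighbourhood in [4 * q ^ 12] vertices; a vertex counts
   as overused when [q ^ 12] edges at it are used, and [q ^ 11] bounds the number of
   overused vertices. *)
Lemma cluster_arith q N : 256 <= q -> q ^ 19 < N -> N <= q ^ 20 ->
  let K := 4 * q ^ 12 * (16 * q * q * (43 * q)) in
  let h := N %/ (4 * q * q) in
  [/\ 2 * K + 2 <= h, K <= q ^ 19, q ^ 11 + 2 * q ^ 12 < 4 * q ^ 12,
      N <= 16 * q * q * (h - K) &
      2 * (2 * N * (2 * q * (20 * q)).+2) <= q ^ 11 * q ^ 12].
Proof.
move=> q256 lN leN K h.
(* High powers of [q] are hidden behind names, leaving low-degree inequalities. *)
have [p hp] : exists p, p = q ^ 11 by exists (q ^ 11).
have [s hs] : exists s, s = q * q by exists (q * q).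
have e12 : q ^ 12 = q * p by rewrite expnS hp.
have p0 : 0 < p by rewrite hp expn_gt0; move: q256; clear; lia.
have s0 : 256 * 256 <= s by rewrite hs; apply: leq_mul.
have [z hz] : exists z, z = s * s * p by exists (s * s * p).
have z0 : 0 < z by rewrite hz !muln_gt0 p0 andbT; move: s0; clear; lia.
have e19 : q ^ 19 = s * s * z.
  rewrite (_ : 19 = 8 + 11) // expnD -hp hz !mulnA; congr (_ * _).
  by rewrite hs !expnS expn0 muln1 !mulnA.
have e23 : q ^ 11 * q ^ 12 = q ^ 20 * (q * s).
  by rewrite -expnD hs (_ : q * (q * q) = q ^ 3) -?expnD // !expnS expn0 muln1.
have eK : K = 2752 * z.
  by rewrite /K e12 hz hs; clear; lia.
have e4 : 4 * q * q = 4 * s by rewrite hs mulnA.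
have e16 : 16 * q * q = 16 * s by rewrite hs mulnA.
have s4 : 0 < 4 * s by move: s0; clear; lia.
have hK : 2 * K + 2 <= h.
  rewrite /h leq_divRL e4 //.
  apply: leq_trans (ltnW lN); rewrite e19 eK.
  rewrite -mulnA [X in _ <= X]mulnC.
  by move: z0 s0; clear; nia.
have Nh : N < 4 * s * h.+1.
  by rewrite mulnC /h e4 ltn_ceil.
split=> //.
- rewrite e19 eK leq_mul2r; apply/orP; right.
  by move: s0; clear; nia.
- by rewrite e12 -hp; move: q256 p0; clear; nia.
- by rewrite e16; move: hK Nh s0; clearbody K h; clear; nia.
rewrite e23 !(mulnA 2) -/(2 * 2); apply: (@leq_trans (4 * q ^ 20 * (40 * s + 2))).
  apply: leq_mul; first by rewrite leq_mul2l leN orbT.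
  by rewrite hs; clear; lia.
rewrite mulnAC mulnC leq_mul2l; apply/orP; right.
by move: q256 s0; clear; nia.
Qed.

Lemma path_vertex_edge (s : seq T) v : 1 < size s -> v \in s ->
  exists2 f, f \in pedges s & v \in f.
Proof.
case: s => // x [|y s] // _; elim: s x y => [|z s IH] x y.
  by move=> vs; exists [set x; y]; rewrite ?mem_head //; move: vs; rewrite !inE.
rewrite in_cons => /orP [/eqP ->|/(IH y z) [f fs vf]].
  by exists [set x; y]; rewrite ?mem_head // !inE eqxx.
by exists f => //; rewrite pedges_cons inE fs orbT.
Qed.

(** The graph outside [W] is split into at most 2|X| paths, each closed into one cycle. What remains
    are edges at [W], at most |W||X| of them. *)
Lemma cluster_reducible E X q : 256 <= q -> simple E -> within E X -> expands E X q ->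
  #|X| <= q ^ 20 -> reducible (2 * #|X|) (q ^ 19 * #|X|) E.
Proof.
move=> q256 sE wE ex Xq.
have [X19|X19] := leqP #|X| (q ^ 19).
  apply: (@reducible_leq _ 0 #|E|) => //; last exact: reducible_self.
  by apply: leq_trans (card_edges sE wE) _; rewrite leq_mul2r X19 orbT.
have [] := cluster_arith q256 X19 Xq.
(* [K] is the bound of [multi_hitting_set] for k = 4q^12, Q = 16q^2 and l = 43q; [t] is the number
   of steps in [level_full] for |X| < 2^(20q). *)
set h := #|X| %/ _; set K := 4 * q ^ 12 * (_ * _); set t := 2 * q * (20 * q).
move=> hK K19 ock NhK tot.
have q0 : 0 < q by apply: leq_trans q256.
have qlt : q < 2 ^ q by apply: ltn_expl.
have X20 : #|X| < 2 ^ (20 * q).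
  by apply: leq_ltn_trans Xq _; rewrite mulnC expnM ltn_exp2r.
have X2 : 1 < #|X| by apply: leq_ltn_trans X19; rewrite expn_gt0 q0.
have h4 : 4 * q * q * h <= #|X| by rewrite mulnC leq_trunc_div.
have full x : x \in X -> level E X h x t = X by apply: level_full.
have rich v : v \in X -> h <= #|nb E v|.
  move=> vX; move: (expands_nb wE ex vX) h4 X2 q0; clearbody h.
  move: #|nb E v| #|X|; clear; nia.
pose Idx := [set p : T * T * 'I_t.+1 | (p.1.1 \in X) && (p.1.2 \in X)].
pose Lv := [set nb E p.1.1 :&: level E X h p.1.2 p.2 | p : T * T * 'I_t.+1 in Idx].
pose Fam := [set A in Lv | h <= #|A|].
(* The two vertices give fewer than 2^(40q) pairs, and the number of levels is at most q^3, hence at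
   most 2^(3q). *)
have cFam : #|Fam| < 2 ^ (43 * q).
  apply: (@leq_ltn_trans (#|X| * #|X| * t.+1)).
    apply: leq_trans (_ : #|setX (setX X X) [set: 'I_t.+1]| <= _); last first.
      by rewrite !cardsX cardsT card_ord.
    apply: (@leq_trans #|Lv|).
      by apply: subset_leq_card; apply/subsetP => A; rewrite inE => /andP [].
    apply: leq_trans (leq_imset_card _ _) _; apply: subset_leq_card.
    by apply/subsetP => -[[v x] i]; rewrite !inE /= andbT.
  have -> : 2 ^ (43 * q) = 2 ^ (20 * q) * 2 ^ (20 * q) * 2 ^ (3 * q).
    by rewrite -!expnD; congr (_ ^ _); clear; lia.
  apply: (@leq_trans (2 ^ (20 * q) * 2 ^ (20 * q) * t.+1)).
    by rewrite ltn_pmul2r //; apply: ltn_mul.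
  rewrite leq_mul2l; apply/orP; right; rewrite (mulnC 3) expnM.
  apply: leq_trans (_ : q ^ 3 <= _); last by rewrite leq_exp2r // ltnW.
  by rewrite /t !expnS expn0; move: q256; clear; nia.
have [||W [WX cW hits]] := @multi_hitting_set _ (4 * q ^ 12) (16 * q * q) (43 * q) X
  Fam _ cFam.
- by rewrite !muln_gt0 q0.
- move=> A; rewrite inE => /andP [/imsetP [[[v x] i] _ ->] /= hA]; rewrite -/K.
  split; first by apply: subset_trans (subsetIl _ _) (nb_sub _ wE).
    by apply: leq_trans hA; apply: leq_trans hK; clearbody K; clear; lia.
  by apply: leq_trans NhK _; rewrite leq_mul2l leq_sub2r ?orbT.
rewrite -/K in cW.
have {}hits x v i : x \in X -> v \in X -> i <= t ->
    h <= #|nb E v :&: level E X h x i| -> 4 * q ^ 12 <= #|nb E v :&: level E X h x i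
      :&: W|.
  move=> xX vX it hA; apply: hits; rewrite inE hA andbT.
  by apply/imsetP; exists (v, x, Ordinal (it : i < t.+1)); rewrite // !inE /= vX.
pose E0 := E :\: touching E W.
have E0E : E0 \subset E := subsetDl _ _.
have [ps [[ups pps] D3 ps2 szps]] := path_decomposition (untouched_within wE :
  within E0 (X :\: W)) (simpleS E0E sE).
have szps2 : size ps <= 2 * #|X|.
  by apply: leq_trans szps _; rewrite leq_mul2l subset_leq_card ?subsetDl ?orbT.
have c3 : 3 <= q ^ 12.
  by apply: leq_trans (leq_pexp2l q0 (isT : 1 <= 12)); rewrite expn1;
    apply: leq_trans q256.
have deg0 v : deg set0 v = 0 by rewrite /deg; apply/eqP; rewrite cards_eq0;
  apply/eqP/setP => f; rewrite !inE.
have [||||||F FW st] := @close_paths T E X W h t _ wE WX full rich hits set0 (q ^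
  12) (q ^ 11) ps sE _ ock (sub0set _) ups ps2.
- by rewrite expn_gt0 q0.
- by rewrite (perm_uniq pps) enum_uniq.
- by move=> f; rewrite (perm_mem pps) mem_enum.
- move=> s v sp vs.
  have : exists2 f, f \in pedges s & v \in f.
    exact: path_vertex_edge (allP ps2 _ sp) vs.
  case=> f fs vf; have fE0 : f \in E0.
    rewrite -mem_enum -(perm_mem pps); apply/flattenP; exists (pedges s) => //.
    exact: map_f.
  by have /subsetP -> := untouched_within wE fE0.
- by move=> v _; rewrite deg0; apply: leq_trans (D3 v) c3.
- rewrite cards0 add0n; apply: leq_trans tot;
    by rewrite leq_mul2l leq_mul2r szps2 !orbT.
exists (size ps), F; split=> //.
  suff <- : [set f in flatten (map (@pedges T) ps)] :|: touching E W :\: set0 = E by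
    [].
  apply/setP => f; rewrite setD0 !inE (perm_mem pps) mem_enum !inE.
  by case: (f \in E) => //=; case: (disjoint _ _).
apply: leq_trans (subset_leq_card FW) _; apply: leq_trans (card_touching W sE wE) _.
by rewrite leq_mul2r (leq_trans cW) ?orbT.
Qed.

(** * Cutting along sparse cuts *)

Lemma card_bigcup_leq (I : finType) (P : pred I) (F : I -> {set {set T}}) :
  #|\bigcup_(i | P i) F i| <= \sum_(i | P i) #|F i|.
Proof.
elim/big_rec2: _ => [|i m A _ IH]; first by rewrite cards0.
by apply: leq_trans (leq_card_setU _ _) _; rewrite leq_add2l.
Qed.

(** The left side is the set of edges across the cut, in the form left by removing the edges inside
    [S] and then those inside [X :\: S]. *)
Lemma card_crossing E X S : simple E -> within E X ->
  #|(E :\: [set f in E | f \subset S]) :\: [set f in E :\: [set f in E | f \subset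
    S] | f \subset X :\: S]|
    <= \sum_(v in X :\: S) #|nb E v :&: S|.
Proof.
move=> sE wE; apply: leq_trans (leq_trans (card_bigcup_leq _
  (fun v => [set [set v; u] | u in nb E v :&: S])) _); last first.
  by apply: leq_sum => v _; apply: leq_imset_card.
apply: subset_leq_card; apply/subsetP => f; rewrite !inE => /andP [nD /andP [nS fE]].
rewrite fE !andbT /= in nS nD; rewrite nS /= in nD.
have [x [y [_ def_f axy]]] := simple_edge sE fE; have [xX yX] := within_adj wE axy.
move: nS nD; rewrite def_f !subUset !sub1set !inE xX yX !andbT negb_and => nS nD.
have : (x \in S) && (y \notin S) || (x \notin S) && (y \in S).
  by move: nS nD; case: (x \in S); case: (y \in S).
case/orP => /andP [xS yS]; apply/bigcupP; [exists y | exists x];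
  rewrite ?inE ?xS ?yS //.
  by rewrite setUC; apply: (imset_f (fun u => [set y; u])); rewrite !inE xS adjC axy.
by apply: (imset_f (fun u => [set x; u])); rewrite !inE yS axy.
Qed.

(** The quadratic term pays for the cuts: when [X] splits into parts of sizes s and d, its square
    exceeds the sum of their squares by 2sd, while fewer than sd/q edges are lost. *)
Lemma dense_reducible_aux E X q : 256 <= q -> simple E -> within E X ->
  #|X| <= q ^ 20 -> exists m, reducible (2 * #|X|) m E /\
    2 * q * m <= 2 * q * q ^ 19 * #|X| + #|X| * #|X|.
Proof.
move=> q256; have [n] := ubnP #|X|; elim: n E X => // n IH E X ltn sE wE Xq.
have [ex|] := boolP [forall S : {set T}, (S \subset X) ==>
    (#|S| * #|X :\: S| <= q * \sum_(v in X :\: S) #|nb E v :&: S|)].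
  exists (q ^ 19 * #|X|); split; last by rewrite mulnA leq_addr.
  apply: cluster_reducible => // S SX; exact: (implyP (forallP ex S) SX).
rewrite negb_forall => /existsP [S]; rewrite negb_imply -ltnNge => /andP [SX cut].
have cX : #|S| + #|X :\: S| = #|X| by rewrite -(cardsID S X) (setIidPr SX).
have : 0 < #|S| * #|X :\: S| by apply: leq_ltn_trans cut.
rewrite muln_gt0 => /andP [S0 D0].
set E1 := [set f in E | f \subset S].
set E2 := [set f in E :\: E1 | f \subset X :\: S].
have E1E : E1 \subset E by apply/subsetP => f; rewrite inE => /andP [].
have E2E : E2 \subset E :\: E1 by apply/subsetP => f; rewrite inE => /andP [].
have sD : simple (E :\: E1) := simpleS (subsetDl _ _) sE.
have [||||m1 [r1 le1]] := IH E1 S.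
- by move: cX ltn D0; clear; lia.
- exact: simpleS sE.
- by move=> f; rewrite inE => /andP [].
- by apply: leq_trans Xq; apply: subset_leq_card.
have [||||m2 [r2 le2]] := IH E2 (X :\: S).
- by move: cX ltn S0; clear; lia.
- exact: simpleS sD.
- by move=> f; rewrite inE => /andP [].
- by apply: leq_trans Xq; apply: subset_leq_card; apply: subsetDl.
have r3 := reducible_self (card_crossing S sE wE); rewrite -/E1 -/E2 in r3.
have := reducible_split E1E r1 (reducible_split E2E r2 r3).
rewrite addn0 -mulnDr cX; set m3 := \sum_(_ in _) _ in cut *.
move=> r; exists (m1 + (m2 + m3)); split=> //; rewrite -cX.
move: le1 le2 cut; clearbody m3; move: #|S| #|X :\: S| (q ^ 19); clear; nia.
Qed.

Lemma dense_reducible E X q : 256 <= q -> simple E -> within E X ->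
  #|X| <= q ^ 20 -> reducible (2 * #|X|) (2 * q ^ 19 * #|X|) E.
Proof.
move=> q256 sE wE Xq; have [m [r le]] := dense_reducible_aux q256 sE wE Xq.
apply: reducible_leq r => //.
have : #|X| * #|X| <= q * q ^ 19 * #|X| by rewrite -expnS leq_mul2r Xq orbT.
move: le q256; move: #|X| (q ^ 19); clear; nia.
Qed.

(** * One round of density reduction *)

Lemma reducible_trans k1 k2 m E : (exists F, strips k1 E F /\ reducible k2 m F) ->
  reducible (k1 + k2) m E.
Proof.
move=> [F [s1 [j [G [s2 jk Gm]]]]]; exists (k1 + j), G; split=> //.
  exact: strips_trans s1 s2.
by rewrite leq_add2l.
Qed.

(** At most |V| long cycles are removed first; the pieces have at most 2|V| vertices in total and
    cost two cycles per vertex. *)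
Lemma round_reducible E V q L : 256 <= q -> 2 < L -> 3 * L <= q ^ 20 ->
  simple E -> within E V -> #|E| <= #|V| * L ->
  reducible (5 * #|V|) (4 * q ^ 19 * #|V|) E.
Proof.
move=> q256 L3 Lq sE wE EL.
have [k [F [sF kL sh]]] := strip_long_cycles E L3.
have FE := strips_sub sF.
have kV : k <= #|V|.
  by rewrite -(@leq_pmul2r L); [apply: leq_trans EL | apply: leq_trans L3].
have := @short_cycles_reducible T L 2 (2 * q ^ 19) (leq_trans _ L3).
move=> /(_ isT) H; have {}H := H _ F V (simpleS FE sE) (withinS FE wE) sh.
apply: (@reducible_leq _ (k + 2 * 2 * #|V|) (2 * (2 * q ^ 19) * #|V|)).
- by move: kV; clear; lia.
- by rewrite mulnA.
apply: reducible_trans; exists F; split=> //; apply: H => E' X sE' wE' X3.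
by apply: dense_reducible => //; apply: leq_trans Lq.
Qed.

Lemma round_exponent E V (x : nat) : 880 <= x -> simple E -> within E V ->
  #|E| <= #|V| * 2 ^ x ->
  exists x' : nat, [/\ 0 < x', 40 * x' <= 39 * x & reducible (5 * #|V|) (#|V| * 2 ^
    x') E].
Proof.
(* With q = 2^y, y is the least integer such that 20y is at least x + 2, which ensures that 3 * 2^x
   is at most q^20. *)
move=> x880 sE wE Ex; pose y := (x + 21) %/ 20.
have y1 : 20 * y <= x + 21 by rewrite mulnC leq_trunc_div.
have y2 : x + 21 < 20 * y.+1 by rewrite mulnC ltn_ceil.
(* This is the exponent of 4q^19. The bound by 39x/40 amounts to 38(x + 21) + 80 being at most 39x,
   true from 878 on. *)
exists (19 * y + 2); split; [lia | lia |].
have -> : #|V| * 2 ^ (19 * y + 2) = 4 * (2 ^ y) ^ 19 * #|V|.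
  by rewrite expnD (mulnC 19) expnM mulnC (mulnC _ (2 ^ 2)).
apply: (round_reducible (L := 2 ^ x)) => //.
- by rewrite -[256]/(2 ^ 8) leq_exp2l //; lia.
- by rewrite -[3]/(2 ^ 1).+1 ltn_exp2l //; lia.
rewrite -expnM; apply: (@leq_trans (2 ^ (2 + x)));
  first by rewrite expnD leq_mul2r orbT.
by rewrite leq_exp2l //; lia.
Qed.

End Rounds.

(** * Iterating the rounds *)

Import Order.TTheory GRing.Theory Num.Theory.
Local Open Scope ring_scope.

Section Bounds.
Variables (R : realType) (T : finType).
Implicit Types (E F : {set {set T}}) (V : {set T}).

(** A round costs 5|V| cycles and lowers ln x by at least ln(40/39), so the term K ln x pays for it.
    Once x is at most [x0], all remaining edges are left as single edges. *)
Lemma iterated_rounds (x0 : nat) (K : R) E V (x : nat) : (880 <= x0)%N ->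
  0 <= K -> 5 <= K * ln (40 / 39) ->
  (0 < x)%N -> simple E -> within E V -> (#|E| <= #|V| * 2 ^ x)%N ->
  exists k F, strips k E F /\
    (k + #|F|)%:R <= #|V|%:R * (K * ln x%:R + 2 ^+ x0).
Proof.
move=> x880 K0 K5; have [n] := ubnP x; elim: n E x => // n IH E x ltn xgt0 sE wE Ex.
have [xx0|x0x] := leqP x x0.
  exists 0%N, E; split; first exact: strips0.
  rewrite add0n; apply: (@le_trans _ _ (#|V| * 2 ^ x0)%N%:R).
    by rewrite ler_nat (leq_trans Ex) // leq_mul2l leq_exp2l // xx0 orbT.
  rewrite natrM natrX ler_wpM2l // lerDr mulr_ge0 // ln_ge0 //.
  by rewrite ler1n.
have x880' : (880 <= x)%N by apply: leq_trans (ltnW x0x).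
have [x' [x'0 x'x [k [F [sF kV FV]]]]] := round_exponent x880' sE wE Ex.
have lt' : (x' < n)%N.
  by move: x'x ltn xgt0; clear; lia.
have FE := strips_sub sF.
have [k' [F' [sF' le']]] := IH F x' lt' x'0 (simpleS FE sE) (withinS FE wE) FV.
exists (k + k')%N, F'; split; first exact: strips_trans sF'.
rewrite -addnA natrD; apply: le_trans (lerD (_ : k%:R <= #|V|%:R * 5) le') _.
  by rewrite -natrM ler_nat mulnC.
rewrite -mulrDr ler_wpM2l // addrA lerD2r.
apply: le_trans (lerD K5 (lexx _)) _; rewrite -mulrDr ler_wpM2l //.
rewrite -lnM ?posrE ?ltr0n //; last by lra.
rewrite ler_ln ?posrE ?ltr0n //; last by rewrite mulr_gt0 ?ltr0n //; lra.
have : (40 * x')%:R <= (39 * x)%:R :> R by rewrite ler_nat.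
rewrite !natrM; lra.
Qed.

End Bounds.

(** * From adjacency relations to edge sets, and the final constant *)

Lemma edge_set_adj (T : finType) (e : rel T) : symmetric e -> adj (edge_set e) =2 e.
Proof.
move=> syme x y; apply/imsetP/idP => [[[u v] /= euv]|exy]; last by exists (x, y).
by case/set2_eq => -[-> ->]; rewrite // syme.
Qed.

Lemma edge_set_simple (T : finType) (e : rel T) : irreflexive e -> simple (edge_set
  e).
Proof.
move=> irr f /imsetP [[u v] /= euv ->]; rewrite cards2.
by case: eqVneq euv => // ->; rewrite inE /= irr.
Qed.

(** The least positive exponent works: if it exceeds 1, minimality gives 2^x < 2m/n, and otherwise
    the lower bound 4 suffices. *)
Lemma log2_exponent (R : realType) (m n : nat) : (0 < n)%N ->
  exists x : nat, [/\ (0 < x)%N, (m <= n * 2 ^ x)%N &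
    x%:R <= log2 (Num.max (2 * m%:R / n%:R) 4) :> R].
Proof.
move=> n0.
have l2 : 0 < ln (2 : R) by rewrite ln_gt0 // ltr1n.
have exP : exists x, (0 < x)%N && (m <= n * 2 ^ x)%N.
  exists m.+1; rewrite /= (leq_trans _ (leq_pmull _ n0)) // ltnW //.
  by apply: ltn_trans (ltn_expl m.+1 (isT : 1 < 2)%N).
case: (ex_minnP exP) => x /andP [x0 mx] xmin; exists x; split=> //.
have M4 : (4 : R) <= Num.max (2 * m%:R / n%:R) 4 by rewrite le_max lexx orbT.
have M0 : 0 < Num.max (2 * m%:R / n%:R) (4 : R) by apply: lt_le_trans M4.
rewrite /log2 ler_pdivlMr // (mulr_natl (ln 2)) -lnXn //.
rewrite ler_ln ?posrE ?exprn_gt0 //.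
case: (ltngtP x 1) x0 => // [x1 _|->];
  last by rewrite expr1 (le_trans _ M4) // ler_nat.
have : (n * 2 ^ x.-1 < m)%N.
  rewrite ltnNge; apply/negP => H; have : (x <= x.-1)%N.
    by apply: xmin; rewrite H andbT -ltnS prednK // ltnW.
  by rewrite leqNgt ltn_predL ltnW.
rewrite -(ltr_nat R) natrM natrX => H.
rewrite le_max; apply/orP; left.
rewrite ler_pdivlMr ?ltr0n // -[x in 2 ^+ x]prednK ?(ltnW x1) // exprS -mulrA
  ler_wpM2l //.
by rewrite mulrC ltW.
Qed.

Theorem theorem1p2 (R : realType) :
  exists2 C : R, 0 < C &
    forall (n : nat) (T : finType) (e : rel T) (d : R),
      (1 <= n)%N -> #|T| = n -> symmetric e -> irreflexive e ->
      d = average_degree R e ->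
      exists2 P : {set {set {set T}}},
        cycle_edge_decomposition e P &
        #|P|%:R <= C * n%:R * log2 (log2 (Num.max d 4)).
Proof.
have l2 : 0 < ln (2 : R) by rewrite ln_gt0 // ltr1n.
have l40 : 0 < ln (40 / 39 : R) by rewrite ln_gt0 //; lra.
pose K : R := 5 / ln (40 / 39).
have K0 : 0 < K by rewrite divr_gt0.
(* A variable in place of 880 keeps the power [2 ^+ x0] from being computed. *)
have [x0 x880] : exists x0, (880 <= x0)%N by exists 880%N.
(* The factor ln 2 converts ln x to base 2; the constant 2^x0 is absorbed because the iterated
   logarithm is at least 1. *)
exists (K * ln 2 + 2 ^+ x0); first by rewrite addr_gt0 ?exprn_gt0 ?ltr0n // mulr_gt0.
move=> n T e d n0 cT syme irr ->.
have sE := edge_set_simple irr.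
have wE : within (edge_set e) [set: T] by move=> f _; apply: subsetT.
have [x [xgt0 Ex xle]] := log2_exponent R #|edge_set e| n0.
rewrite -cT -cardsT in Ex.
have K5 : 5 <= K * ln (40 / 39) by rewrite divfK ?gt_eqF.
have [k [F [st le]]] := iterated_rounds x880 (ltW K0) K5 xgt0 sE wE Ex.
have [P [pP cP HP]] := strips_decomposition st.
exists P.
  split=> // C /HP [[c [c2 uc cc ->]]|[f fE ->]]; [left|right]; last by exists f.
  exists c => //; split=> //; apply/andP; split=> //.
  by rewrite -(eq_cycle (edge_set_adj syme)).
rewrite /average_degree cT; set L := log2 _ in xle *.
apply: le_trans (_ : (k + #|F|)%:R <= _); first by rewrite ler_nat.
apply: le_trans le _; rewrite cardsT cT [leRHS]mulrAC [leRHS]mulrC ler_wpM2l ?ler0n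
  //.
have x1 : 1 <= x%:R :> R by rewrite ler1n.
(* This is where the maximum with 4 enters. *)
have L2 : 2 <= L.
  rewrite /L /log2 ler_pdivlMr // (mulr_natl (ln 2)) -lnXn // ler_ln ?posrE
    ?exprn_gt0 //.
    by rewrite le_max; apply/orP; right; rewrite -natrX.
  by rewrite lt_max ltr0n orbT.
have L1 : 1 <= log2 L.
  by rewrite /log2 ler_pdivlMr // mul1r ler_ln ?posrE // (lt_le_trans _ L2).
have lnL : ln x%:R <= ln 2 * log2 L.
  rewrite /log2 mulrC divfK ?gt_eqF // ler_ln ?posrE ?ltr0n //.
  by rewrite (lt_le_trans _ L2).
rewrite mulrDl; apply: lerD; first by rewrite -(mulrA K) ler_wpM2l ?(ltW K0).
by apply: ler_peMr => //; apply: exprn_ge0.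
Qed.
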